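(* Let $p$ be $0$ or a prime, let $\varkappa$ be a cardinal, and let $(K,|\cdot|)$ be a valued field whose residue class field has characteristic $p$. Let $R$ be a bottomed linearly ordered set such that $R\setminus\{\circledcirc_R\}$ is a divisible linearly ordered Abelian (multiplicative) group and $\{|x|\mid x\in K\}\subseteq R$. Then there exists a valued field $(L,\|\cdot\|)$ such that: (1) $L$ is a valued field extension of $K$; (2) $\{\|x\|\mid x\in L\}=R$; (3) for each $R$-valued ultrametric space $(X,d)$ with either $X=\emptyset$ or $\mathrm{Card}(X\sqcup\{\ast\})\le\varkappa$ for some $\ast\notin X$, there exists an isometric embedding $I\colon(X,d)\to(L,\|\cdot\|)$ such that the set $I(X)$ is algebraically independent over $K$. Moreover, for every $R$-valued ultrametric space $(X,d)$, there exist a valued field $(F,\|\cdot\|)$ and a map $I\colon X\to F$ such that: (1) $I\colon(X,d)\to(F,\|\cdot\|)$ is an isometric embedding; (2) $(F,\|\cdot\|)$ is a valued field extension of $(K,|\cdot|)$; (3) for every $x\in F$ we have $\|x\|\in R$; (4) $I(X)$ is closed in $F$; (5) $I(X)$ is algebraically independent over $K$; (6) if $(X,d)$ is complete as a uniform space, then $(F,\|\cdot\|)$ can be chosen to be complete.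
   Context: A linearly ordered set $R$ is bottomed if it has a minimum element, denoted $\circledcirc_R$. Here $R\setminus\{\circledcirc_R\}$ is a linearly ordered Abelian group written multiplicatively (not necessarily a subgroup of $\mathbb{R}_{>0}$), and $\circledcirc_R$ is absorbing for multiplication. Divisible means that every element has an $n$-th root for every $n\ge1$. In this statement valued fields have values in such sets: a field $L$ with a map $\|\cdot\|\colon L\to R$ such that $\|x\|=\circledcirc_R$ iff $x=0$, $\|xy\|=\|x\|\cdot\|y\|$, and $\|x+y\|\le\max\{\|x\|,\|y\|\}$; the value group of $K$ is an ordered subgroup of $R\setminus\{\circledcirc_R\}$. The residue class field is $\{\|x\|\le1\}/\{\|x\|<1\}$. $(L,\|\cdot\|)$ is a valued field extension of $(K,|\cdot|)$ if $K$ is a subfield of $L$ and $\|\cdot\|$ restricts to $|\cdot|$ on $K$. An $R$-valued ultrametric on $X$ is a symmetric map $d\colon X\times X\to R$ with $d(x,y)=\circledcirc_R$ iff $x=y$ and $d(x,y)\le\max\{d(x,z),d(z,y)\}$. It induces the uniformity generated by the sets $\{(x,y)\mid d(x,y)<\varepsilon\}$, $\varepsilon\in R\setminus\{\circledcirc_R\}$. A valued field is regarded as an $R$-valued ultrametric space by $(x,y)\mapsto\|x-y\|$; closedness and completeness refer to the induced topology and uniformity. An isometric embedding is a map preserving these distances. A set is algebraically independent over $K$ if no finite collection of distinct elements of it satisfies a non-trivial polynomial equation over $K$. *)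

(* Defs.v *)
From HB Require Import structures.
From mathcomp Require Import all_boot all_order all_algebra ring_quotient.
From mathcomp Require Import all_classical topology.
From mathcomp Require mpoly.
Import (canonicals, coercions) mpoly.

Set Implicit Arguments.
Unset Strict Implicit.
Unset Printing Implicit Defensive.

Import Order.TTheory GRing.Theory.

Local Open Scope classical_set_scope.
Local Open Scope ring_scope.

(* A linearly ordered set with least element [\bot] whose nonbottom elements
   form a linearly ordered abelian group, [\bot] being absorbing.  Closure of
   the nonbottom elements under [vmul] follows from [vmulV_ex] and [vmul_botl];
   the laws below hold trivially at [\bot]. *)
HB.mixin Record isBottomedGroup (d : Order.disp_t) R & Order.BTotal d R := {
  vone : R;
  vmul : R -> R -> R;
  vone_neq_bot : vone != \bot%O;
  vmulA : associative vmul;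
  vmulC : commutative vmul;
  vmul1 : left_id vone vmul;
  vmul_botl : left_zero \bot%O vmul;
  vmulV_ex : forall x : R, x != \bot%O -> exists y, vmul y x = vone;
  vmul_le2l : forall z x y : R, (x <= y)%O -> (vmul z x <= vmul z y)%O
}.

#[short(type="bottomedGroupType")]
HB.structure Definition BottomedGroup (d : Order.disp_t) :=
  { R of Order.BTotal d R & isBottomedGroup d R }.

Arguments vone {d s}.
Arguments vmulV_ex {d s x}.
Arguments vmul_le2l {d s} z {x y}.

Definition vexp d (R : bottomedGroupType d) (x : R) (n : nat) : R :=
  iter n (vmul x) vone.

Definition divisible d (R : bottomedGroupType d) : Prop :=
  forall (x : R) (n : nat), x != \bot%O -> (0 < n)%N ->
    exists2 y : R, y != \bot%O & vexp y n = x.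

Record valuation d (R : bottomedGroupType d) (K : fieldType) := Valuation {
  val_fun :> K -> R;
  val_eq_bot : forall x, val_fun x = \bot%O <-> x = 0;
  valM : forall x y, val_fun (x * y) = vmul (val_fun x) (val_fun y);
  val_ultra : forall x y,
    (val_fun (x + y) <= Order.max (val_fun x) (val_fun y))%O
}.

Record ultrametric d (R : bottomedGroupType d) (X : Type) := Ultrametric {
  udist :> X -> X -> R;
  udist_sym : forall x y, udist x y = udist y x;
  udist_eq_bot : forall x y, udist x y = \bot%O <-> x = y;
  udist_ultra : forall x y z,
    (udist x y <= Order.max (udist x z) (udist z y))%O
}.

Section BottomedGroupTheory.
Context {d : Order.disp_t} {R : bottomedGroupType d}.
Implicit Types x y z : R.

Lemma vmul_lt2l z x y : z != \bot%O -> (x < y)%O -> (vmul z x < vmul z y)%O.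
Proof.
move=> z0 xy; rewrite lt_neqAle vmul_le2l ?ltW // andbT.
apply: contraTneq xy => e; have [w wz] := vmulV_ex z0.
by rewrite -(vmul1 x) -(vmul1 y) -wz -!vmulA e ltxx.
Qed.

Lemma vsqr_eq1 x : vmul x x = vone -> x = vone.
Proof.
move=> xx; have x0 : x != \bot%O.
  by apply: contra_eq_neq xx => ->; rewrite vmul_botl eq_sym vone_neq_bot.
case: (ltgtP x vone) => // h; have := vmul_lt2l x0 h;
  by rewrite xx (vmulC x) vmul1 => /(lt_trans h); rewrite ltxx.
Qed.

End BottomedGroupTheory.

Section ValuationTheory.
Context {d : Order.disp_t} {R : bottomedGroupType d} {K : fieldType}.
Variable v : valuation R K.

Lemma val0 : v 0 = \bot%O.
Proof. exact/val_eq_bot. Qed.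

Lemma val_neq_bot x : x != 0 -> v x != \bot%O.
Proof. by apply: contra_neq => /val_eq_bot. Qed.

Lemma val1 : v 1 = vone.
Proof.
have [w w1] := vmulV_ex (val_neq_bot (oner_neq0 K)).
by rewrite -(vmul1 (v 1)) -w1 -vmulA -valM mulr1.
Qed.

Lemma valN x : v (- x) = v x.
Proof.
rewrite -mulN1r valM; suff -> : v (-1) = vone by rewrite vmul1.
by apply: vsqr_eq1; rewrite -valM mulrNN mulr1 val1.
Qed.

Lemma valB x y : v (x - y) = v (y - x).
Proof. by rewrite -valN opprB. Qed.

Lemma valuation_dist_eq_bot x y : v (x - y) = \bot%O <-> x = y.
Proof. by rewrite val_eq_bot; split=> [/subr0_eq //|->]; rewrite subrr. Qed.

Lemma valuation_dist_ultra x y z :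
  (v (x - y) <= Order.max (v (x - z)) (v (z - y)))%O.
Proof. by have := val_ultra v (x - z) (z - y); rewrite addrA subrK. Qed.

Definition valuation_ultrametric : ultrametric R K :=
  Ultrametric valB valuation_dist_eq_bot valuation_dist_ultra.

Definition vring_pred : {pred K} := fun x => (v x <= vone)%O.

Lemma vring_subring_closed : subring_closed vring_pred.
Proof.
split=> [|x y|x y]; rewrite !unfold_in ?val1 // => x1 y1.
  by apply: le_trans (val_ultra _ _ _) _; rewrite valN ge_max x1.
rewrite valM; apply: le_trans (vmul_le2l _ y1) _.
by rewrite vmulC vmul1.
Qed.

HB.instance Definition _ :=
  GRing.isSubringClosed.Build K vring_pred vring_subring_closed.

Record valuation_ring := ValuationRing {
  vring_val :> K;
  vring_valP : vring_val \in vring_pred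
}.

HB.instance Definition _ := [isSub for vring_val].
HB.instance Definition _ := [Choice of valuation_ring by <:].
HB.instance Definition _ :=
  [SubChoice_isSubComNzRing of valuation_ring by <:].

Definition maximal_ideal : {pred valuation_ring} :=
  fun x => (v (val x) < vone)%O.

Lemma maximal_ideal_closed : idealr_closed maximal_ideal.
Proof.
split=> [||a x y]; rewrite !unfold_in ?val0 ?lt0x ?vone_neq_bot //.
  by rewrite val1 ltxx.
move=> x1 y1; apply: le_lt_trans (val_ultra _ _ _) _.
rewrite gt_max y1 andbT valM; apply: le_lt_trans x1.
have := vmul_le2l (v (val x)) (vring_valP a).
by rewrite vmulC (vmulC _ vone) vmul1.
Qed.

HB.instance Definition _ :=
  isIdealr.Build valuation_ring maximal_ideal maximal_ideal_closed.

Definition residue_field : Type := {ideal_quot maximal_ideal}.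
HB.instance Definition _ := GRing.ComNzRing.on residue_field.

Local Notation pi := (\pi_{ideal_quot maximal_ideal}%qT).

Definition residue_inv (q : residue_field) : residue_field :=
  pi (insubd (0 : valuation_ring) (val (repr q))^-1).

Lemma residue_pi_eq0 (x : valuation_ring) :
  (pi x == 0) = (x \in maximal_ideal).
Proof.
by rewrite -[x in RHS]subr0 Quotient.idealrBE; congr (_ == _); rewrite piE.
Qed.

Lemma valV x y : vmul (v x) y = vone -> y = v x^-1.
Proof.
move=> xy; have x0 : x != 0.
  apply: contra_eq_neq xy => ->.
  by rewrite val0 vmul_botl eq_sym vone_neq_bot.
by rewrite -[y]vmul1 -val1 -(mulVf x0) valM -vmulA xy vmulC vmul1.
Qed.

Lemma residue_mulVf (q : residue_field) : q != 0 -> residue_inv q * q = 1.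
Proof.
rewrite -{1 3}[q]reprK residue_pi_eq0 unfold_in -leNgt => q1.
have v1 : v (val (repr q)) = vone.
  by apply/le_anti; rewrite q1 andbT; exact: (vring_valP (repr q)).
have q0 : val (repr q) != 0.
  by apply: contra_eq_neq v1 => ->; rewrite val0 eq_sym vone_neq_bot.
have vV : (val (repr q))^-1 \in vring_pred.
  by rewrite unfold_in -(@valV _ vone) ?v1 ?vmul1.
rewrite /residue_inv -rmorphM -[RHS](rmorph1 pi); congr (pi _).
by apply: val_inj; rewrite rmorphM /= insubdK // mulVf.
Qed.

Lemma residue_inv0 : residue_inv 0 = 0.
Proof.
apply/eqP; rewrite /residue_inv residue_pi_eq0 unfold_in.
set x := val (repr _).
have x1 : (v x < vone)%O.
  have := residue_pi_eq0 (repr (0 : {ideal_quot maximal_ideal})).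
  by rewrite reprK eqxx unfold_in; exact: esym.
have bot1 : (\bot < vone :> R)%O by rewrite lt0x vone_neq_bot.
have [->|x0] := eqVneq x 0.
  by rewrite invr0 insubdK ?unfold_in ?val0 // ltW.
rewrite val_insubd ifN ?val0 //; rewrite unfold_in -ltNge.
have := vmul_lt2l (val_neq_bot (invr_neq0 x0)) x1.
by rewrite -valM mulVf // val1 vmulC vmul1.
Qed.

HB.instance Definition _ :=
  GRing.ComNzRing_isField.Build residue_field residue_mulVf residue_inv0.

End ValuationTheory.

(* With [p = 0] or [p] prime, [p] is the characteristic of [S]. *)
Definition has_characteristic (S : nzRingType) (p : nat) : Prop :=
  if p == 0%N then [pchar S] =i pred0 else p \in [pchar S].

Section UltrametricUniformity.
Context {d : Order.disp_t} {R : bottomedGroupType d} {X : choiceType}.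

(* A copy of [X], carrying the uniformity induced by [D]. *)
Definition ultrametric_space (D : ultrametric R X) : Type := X.

Variable D : ultrametric R X.

Definition ultrametric_entourage :
    set_system (ultrametric_space D * ultrametric_space D) :=
  filter_from [set e : R | e != \bot%O]
              (fun e => [set xy | (D xy.1 xy.2 < e)%O]).

Lemma ultrametric_entourage_filter : Filter ultrametric_entourage.
Proof.
apply: filter_from_filter; first by exists vone; exact: vone_neq_bot.
move=> e f e0 f0; exists (Order.min e f) => /=; first by case: leP.
by move=> xy /=; rewrite lt_min => /andP[].
Qed.

Local Open Scope relation_scope.

Lemma ultrametric_entourage_diagonal A :
  ultrametric_entourage A -> diagonal `<=` A.
Proof.
move=> [e /= e0 eA] [x y] /= xy; apply: eA => /=.
by rewrite (udist_eq_bot D x y).2 ?lt0x.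
Qed.

Lemma ultrametric_entourage_inv A :
  ultrametric_entourage A -> ultrametric_entourage A^-1.
Proof.
move=> [e /= e0 eA]; exists e => //= -[x y] /= xy.
by apply: eA; rewrite /= udist_sym.
Qed.

Lemma ultrametric_entourage_split A : ultrametric_entourage A ->
  exists2 B, ultrametric_entourage B & B \; B `<=` A.
Proof.
move=> [e /= e0 eA]; exists [set xy | (D xy.1 xy.2 < e)%O]; first by exists e.
move=> [x y] [z /= xz zy]; apply: eA => /=.
by apply: le_lt_trans (udist_ultra D x y z) _; rewrite gt_max xz.
Qed.

HB.instance Definition _ := Choice.copy (ultrametric_space D) X.
HB.instance Definition _ := isUniform.Build (ultrametric_space D)
  ultrametric_entourage_filter ultrametric_entourage_diagonal
  ultrametric_entourage_inv ultrametric_entourage_split.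

Definition ultrametric_closed (A : set X) : Prop :=
  @closed (ultrametric_space D) A.

End UltrametricUniformity.

(* The axiom of [completeType], without its requirement that the space be
   pointed: the empty space is complete. *)
Definition complete_uniform (U : uniformType) : Prop :=
  forall F : set_system U, ProperFilter F -> cauchy F -> exists x : U, F --> x.

Definition isometric_embedding d (R : bottomedGroupType d) (X Y : Type)
    (DX : ultrametric R X) (DY : ultrametric R Y) (f : X -> Y) : Prop :=
  forall x y, DY (f x) (f y) = DX x y.

Definition valued_extension d (R : bottomedGroupType d) (K L : fieldType)
    (vK : valuation R K) (vL : valuation R L) (j : {rmorphism K -> L}) : Prop :=
  forall x, vL (j x) = vK x.

Definition algebraically_independent (K L : fieldType) (j : {rmorphism K -> L})
    (S : set L) : Prop :=
  forall (n : nat) (t : 'I_n -> L), injective t -> (forall i, S (t i)) ->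
  forall P : mpoly.mpoly n K, mpoly.mmap j t P = 0 -> P = 0.

(* Main.v *)
From HB Require Import structures.
From mathcomp Require Import all_boot all_order all_algebra.
From mathcomp Require Import ring_quotient fraction.
From mathcomp Require Import all_classical topology.
From mathcomp Require finmap monalg mpoly.
Require Import Defs.
Import (canonicals, coercions) mpoly.

(** The field is K(T_x : x in X), with the valuation for which T_x - T_y has
    value d(x, y), algebraic independence being automatic.  An auxiliary point,
    where the variable is 0, fixes the values of the T_x themselves.  For a
    finite set of variables the valuation is an iterated Gauss norm: if p is a
    point nearest to x among those already treated, a polynomial is expanded in
    powers of T_x - T_p and its norm is the maximum of |a_i| d(x, p)^i.  This
    norm is the largest one with |T_x - T_y| <= d(x, y), so it does not depend on
    the enumeration and the norms of all finite sets of variables glue.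
    If f only involves variables in S and p in S is nearest to x, then
    |f - T_x| >= |f - T_p|; as S is finite, f is a limit of variables only if it
    is one of them, which gives closedness.  When X is complete the field is
    replaced by its completion, where a complete subspace stays closed.
    The universal field L comes from a universal ultrametric space: the wedge sum
    of all ultrametrics on a sufficiently large set. *)

Set Implicit Arguments.
Unset Strict Implicit.
Unset Printing Implicit Defensive.

Import Order.TTheory GRing.Theory.

Local Open Scope classical_set_scope.
Local Open Scope ring_scope.
Local Open Scope card_scope.

(** * Arithmetic in bottomed ordered groups *)

Section BottomedGroup.
Context {d : Order.disp_t} {R : bottomedGroupType d}.
Implicit Types x y z b : R.

Lemma vmul_botr x : vmul x \bot%O = \bot%O.
Proof. by rewrite vmulC vmul_botl. Qed.

Lemma vmulr1 x : vmul x vone = x.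
Proof. by rewrite vmulC vmul1. Qed.

Lemma vmulCA x y z : vmul x (vmul y z) = vmul y (vmul x z).
Proof. by rewrite vmulA (vmulC x) -vmulA. Qed.

Lemma vmulACA x y z t : vmul (vmul x y) (vmul z t) = vmul (vmul x z) (vmul y t).
Proof. by rewrite -!vmulA (vmulCA y). Qed.

Lemma vmul_le x y z t : (x <= y)%O -> (z <= t)%O -> (vmul x z <= vmul y t)%O.
Proof.
move=> xy zt; apply: (le_trans (vmul_le2l x zt)).
by rewrite vmulC (vmulC y); exact: vmul_le2l.
Qed.

Lemma vmulI x : x != \bot%O -> injective (vmul x).
Proof.
move=> x0 y z e; have [w wx] := vmulV_ex x0.
by rewrite -(vmul1 y) -(vmul1 z) -wx -!vmulA e.
Qed.

Lemma vmul_neq_bot x y : x != \bot%O -> y != \bot%O -> vmul x y != \bot%O.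
Proof.
move=> x0; apply: contra_neq => xy; apply: (vmulI x0).
by rewrite xy vmul_botr.
Qed.

Lemma vmul_le_lt x y z t : y != \bot%O ->
  (x <= y)%O -> (z < t)%O -> (vmul x z < vmul y t)%O.
Proof.
move=> y0 xy zt; apply: le_lt_trans (vmul_lt2l y0 zt).
exact: vmul_le.
Qed.

Lemma vmul_max x y z :
  vmul x (Order.max y z) = Order.max (vmul x y) (vmul x z).
Proof.
case: (leP y z) => h; first by rewrite max_r // vmul_le2l.
by rewrite max_l // vmul_le2l // ltW.
Qed.

Lemma vexpS x n : vexp x n.+1 = vmul x (vexp x n).
Proof. by []. Qed.

Lemma vexpD x m n : vexp x (m + n) = vmul (vexp x m) (vexp x n).
Proof. by elim: m => [|m IHm]; rewrite ?vmul1 // addSn !vexpS IHm vmulA. Qed.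

Lemma vexp_neq_bot x n : x != \bot%O -> vexp x n != \bot%O.
Proof.
by move=> x0; elim: n => [|n IHn]; [exact: vone_neq_bot | exact: vmul_neq_bot].
Qed.

Lemma vmul_le2lI z x y :
  z != \bot%O -> (vmul z x <= vmul z y)%O -> (x <= y)%O.
Proof. by move=> z0; case: (leP x y) => // /(vmul_lt2l z0); case: leP. Qed.

(** Continuity of multiplication at [\bot], uniform in factors bounded by [m]: the threshold is e /
    m. *)
Lemma vmul_small m e : m != \bot%O -> e != \bot%O ->
  exists2 e' : R, e' != \bot%O &
    forall x y, (x <= m)%O -> (y < e')%O -> (vmul x y < e)%O.
Proof.
move=> m0 e0; have [w wm] := vmulV_ex m0.
have w0 : w != \bot%O.
  by apply: contra_eq_neq wm => ->; rewrite vmul_botl eq_sym vone_neq_bot.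
exists (vmul w e); first exact: vmul_neq_bot.
move=> x y xm yw; rewrite -[e]vmul1 -wm (vmulC w) -vmulA.
exact: vmul_le_lt.
Qed.

Lemma exists_neq_bot_le (T : eqType) (s : seq T) (w : T -> R) :
  (forall t, t \in s -> w t != \bot%O) ->
  exists2 e : R, e != \bot%O & forall t, t \in s -> (e <= w t)%O.
Proof.
elim: s => [|t s IHs] ws; first by exists vone; rewrite ?vone_neq_bot.
have [u us|e e0 es] := IHs; first by rewrite ws // inE us orbT.
exists (Order.min e (w t)); first by case: leP => // _; rewrite ws ?inE ?eqxx.
move=> u; rewrite inE ge_min => /predU1P[->|/es ->//].
by rewrite lexx orbT.
Qed.

End BottomedGroup.

(** * Gauss norms on polynomials in one variable *)

Section GaussNorm.
Context {d : Order.disp_t} {R : bottomedGroupType d} {A : comNzRingType}.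
Variables (G : A -> Prop) (N : A -> R) (r : R).
Hypothesis r0 : r != \bot%O.
Hypothesis G0 : G 0.
Hypothesis GN : forall a, G a -> G (- a).
Hypothesis GD : forall a b, G a -> G b -> G (a + b).
Hypothesis GM : forall a b, G a -> G b -> G (a * b).
Hypothesis N0 : N 0 = \bot%O.
Hypothesis NN : forall a, G a -> N (- a) = N a.
Hypothesis ND :
  forall a b, G a -> G b -> (N (a + b) <= Order.max (N a) (N b))%O.
Hypothesis NM : forall a b, G a -> G b -> N (a * b) = vmul (N a) (N b).

Implicit Types p q : {poly A}.

(** The laws of [N] for sums and products are assumed only on [G], because later [N] is controlled
    only on polynomials in finitely many variables. *)
Definition gauss_norm q : R :=
  \big[Order.max / \bot%O]_(i < size q) vmul (N q`_i) (vexp r i).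

Lemma gauss_norm_leP q b :
  (forall i, (vmul (N q`_i) (vexp r i) <= b)%O) <-> (gauss_norm q <= b)%O.
Proof.
split=> [h|/bigmax_leP[_ h] i]; first by apply/bigmax_leP; rewrite le0x.
case: (ltnP i (size q)) => [iq|/(nth_default 0) ->]; first exact: (h (Ordinal iq)).
by rewrite N0 vmul_botl le0x.
Qed.

Lemma gauss_norm_ge q i : (vmul (N q`_i) (vexp r i) <= gauss_norm q)%O.
Proof. by move: i; apply/gauss_norm_leP. Qed.

Lemma gauss_norm_attained q : gauss_norm q != \bot%O ->
  exists i, vmul (N q`_i) (vexp r i) == gauss_norm q.
Proof.
move=> q0; apply: contrapT => /forallNP h.
have : (gauss_norm q < gauss_norm q)%O; last by rewrite ltxx.
apply/bigmax_ltP; split=> [|i _]; first by rewrite lt0x.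
by rewrite lt_neqAle gauss_norm_ge andbT; apply/negP/h.
Qed.

Lemma gauss_normD p q : (forall i, G p`_i) -> (forall i, G q`_i) ->
  (gauss_norm (p + q) <= Order.max (gauss_norm p) (gauss_norm q))%O.
Proof.
move=> Gp Gq; apply/gauss_norm_leP => i; rewrite coefD vmulC.
apply: (le_trans (vmul_le2l _ (ND (Gp i) (Gq i)))).
by rewrite vmul_max !(vmulC (vexp r i)) le_max2 // gauss_norm_ge.
Qed.

(** Membership in [G] is carried through the induction, since [ND] applies only there. The empty sum
    meets the strict bound because [b] is not [\bot]. *)
Lemma norm_sum_lt (I : Type) (s : seq I) (P : pred I) (F : I -> A) b :
  b != \bot%O -> (forall i, P i -> G (F i)) ->
  (forall i, P i -> (N (F i) < b)%O) -> (N (\sum_(i <- s | P i) F i)%R < b)%O.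
Proof.
move=> b0 GF Fb; suff [] : G (\sum_(i <- s | P i) F i) /\
  (N (\sum_(i <- s | P i) F i)%R < b)%O by [].
elim/big_rec: _ => [|i x Pi [Gx xb]]; first by rewrite N0 lt0x.
split; first by apply: GD => //; apply: GF.
by apply: le_lt_trans (ND (GF i Pi) Gx) _; rewrite gt_max Fb.
Qed.

Lemma norm_sum_le (I : Type) (s : seq I) (P : pred I) (F : I -> A) b :
  (forall i, P i -> G (F i)) ->
  (forall i, P i -> (N (F i) <= b)%O) -> (N (\sum_(i <- s | P i) F i)%R <= b)%O.
Proof.
move=> GF Fb; suff [] : G (\sum_(i <- s | P i) F i) /\
  (N (\sum_(i <- s | P i) F i)%R <= b)%O by [].
elim/big_rec: _ => [|i x Pi [Gx xb]]; first by rewrite N0 le0x.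
split; first by apply: GD => //; apply: GF.
by apply: le_trans (ND (GF i Pi) Gx) _; rewrite ge_max Fb.
Qed.

(** Since a = (a + b) - b, having N (a + b) at most N b would force N a at most N b. *)
Lemma norm_dominant a b : G a -> G b -> (N b < N a)%O -> N (a + b) = N a.
Proof.
move=> Ga Gb ba; apply/le_anti/andP; split.
  by apply: le_trans (ND Ga Gb) _; rewrite ge_max lexx ltW.
have := ND (GD Ga Gb) (GN Gb); rewrite addrK (NN Gb).
by case: (leP (N (a + b)) (N b)) => // _ /(lt_le_trans ba); rewrite ltxx.
Qed.

(** Gauss's lemma: the upper bound holds term by term, and the lower bound comes from one
    coefficient in which nothing cancels. *)
Lemma gauss_normM p q : (forall i, G p`_i) -> (forall i, G q`_i) ->
  gauss_norm (p * q) = vmul (gauss_norm p) (gauss_norm q).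
Proof.
move=> Gp Gq.
have split_term m k : (k <= m)%N ->
    vmul (N (p`_k * q`_(m - k))) (vexp r m) =
    vmul (vmul (N p`_k) (vexp r k)) (vmul (N q`_(m - k)) (vexp r (m - k))).
  by move=> km; rewrite NM // vmulACA -vexpD subnKC.
have Gpq k l : G (p`_k * q`_l) by exact: GM.
apply/le_anti/andP; split.
  apply/gauss_norm_leP => m.
  (* Bounds on sums concern [N] alone, so the weight [vexp r m] is divided out through its inverse
     [w]. *)
  have [w wr] := vmulV_ex (vexp_neq_bot m r0).
  rewrite -[X in (_ <= X)%O]vmulr1 -wr vmulA; apply: vmul_le => //.
  rewrite coefM; apply: norm_sum_le => // k _.
  rewrite -[N _]vmulr1 -wr (vmulC w) vmulA; apply: vmul_le => //.
  rewrite split_term; last by rewrite -ltnS.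
  by apply: vmul_le; exact: gauss_norm_ge.
have [->|p0] := eqVneq (gauss_norm p) \bot%O; first by rewrite vmul_botl le0x.
have [->|q0] := eqVneq (gauss_norm q) \bot%O; first by rewrite vmul_botr le0x.
(* Let i and j be the least indices at which the two norms are attained:
   the term p_i q_j strictly dominates the coefficient of index i + j. *)
case: (ex_minnP (gauss_norm_attained p0)) => i /eqP ip imin.
case: (ex_minnP (gauss_norm_attained q0)) => j /eqP jq jmin.
have p_lt k : (k < i)%N -> (vmul (N p`_k) (vexp r k) < gauss_norm p)%O.
  rewrite lt_neqAle gauss_norm_ge andbT; apply: contraTN => /imin.
  by rewrite -leqNgt.
have q_lt k : (k < j)%N -> (vmul (N q`_k) (vexp r k) < gauss_norm q)%O.
  rewrite lt_neqAle gauss_norm_ge andbT; apply: contraTN => /jmin.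
  by rewrite -leqNgt.
set gg := vmul (gauss_norm p) (gauss_norm q).
suff e : vmul (N (p * q)`_(i + j)) (vexp r (i + j)) = gg.
  by rewrite -e gauss_norm_ge.
have ir : (i < (i + j).+1)%N by rewrite ltnS leq_addr.
have ggE : gg = vmul (N (p`_i * q`_j)) (vexp r (i + j)).
  by have := split_term _ _ (leq_addr j i); rewrite addKn ip jq => ->.
have [w wr] := vmulV_ex (vexp_neq_bot (i + j) r0).
rewrite ggE coefM (bigD1 (Ordinal ir)) //= addKn norm_dominant //.
  by elim/big_ind: _.
have NE : N (p`_i * q`_j) = vmul gg w by rewrite ggE -vmulA (vmulC _ w) wr vmulr1.
have w0 : w != \bot%O.
  by apply: contra_eq_neq wr => ->; rewrite vmul_botl eq_sym vone_neq_bot.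
have gg0 : gg != \bot%O by exact: vmul_neq_bot.
apply: norm_sum_lt => [||k ki]; rewrite ?NE ?vmul_neq_bot //.
rewrite -[N _]vmulr1 -wr (vmulC w) vmulA !(vmulC _ w) vmul_lt2l //.
rewrite split_term; last by rewrite -ltnS.
have {}ki : k != i :> nat by [].
(* If k < i, the factor from p is strictly below its norm. If k > i, then i + j - k < j and the
   factor from q is. *)
case: (ltngtP k i) ki => // kilt _.
  by rewrite vmulC /gg [vmul (gauss_norm p) _]vmulC vmul_le_lt ?gauss_norm_ge ?p_lt.
apply: vmul_le_lt; rewrite ?gauss_norm_ge // q_lt //.
by rewrite ltn_subLR ?ltn_add2r // -ltnS.
Qed.

End GaussNorm.

(** * Polynomial algebras in arbitrary sets of variables, by lifting and induction *)

Record free_algebra (K : fieldType) (X : choiceType) := FreeAlgebra {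
  falg :> comNzRingType;
  falgC : {rmorphism K -> falg};
  falgX : X -> falg;
  falg_lift : forall (S : comNzRingType) (f : {rmorphism K -> S}) (t : X -> S),
    exists g : {rmorphism falg -> S},
      (forall c, g (falgC c) = f c) /\ (forall x, g (falgX x) = t x);
  falg_ind : forall P : falg -> Prop,
    (forall c, P (falgC c)) -> (forall x, P (falgX x)) ->
    (forall a b, P a -> P b -> P (a + b)) ->
    (forall a b, P a -> P b -> P (a * b)) -> forall a, P a
}.

Module Malg.
Import finmap monalg.

Section Malg.
Variables (K : fieldType) (X : choiceType).
Local Notation A := {malg K[{cmonom X}]}.

Section Lift.
Variables (S : comNzRingType) (f : {rmorphism K -> S}) (t : X -> S).

Definition monom_eval (m : {cmonom X}) : S := \prod_(x <- finsupp m) t x ^+ m x.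

Lemma monom_evalEw (m : {cmonom X}) (D : {fset X}) : (finsupp m `<=` D)%fset ->
  monom_eval m = \prod_(x <- D) t x ^+ m x.
Proof.
move=> mD; rewrite /monom_eval (big_fset_incl _ mD) //= => x _.
by rewrite -cmE_eq0 => /eqP ->; rewrite expr0.
Qed.

Lemma monom_eval_mmorphism : mmorphism monom_eval.
Proof.
split=> [m n|]; last by rewrite /monom_eval mdom1 big_seq_fset0.
rewrite (monom_evalEw (fsubsetUl (finsupp m) (finsupp n))).
rewrite (monom_evalEw (fsubsetUr (finsupp m) (finsupp n))) -big_split.
by rewrite {1}/monom_eval mdomD; apply: eq_bigr => x _; rewrite cmM exprD.
Qed.

HB.instance Definition _ :=
  isMultiplicative.Build {cmonom X} S monom_eval monom_eval_mmorphism.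

Lemma malg_lift : exists g : {rmorphism A -> S},
  (forall c, g (@malgC {cmonom X} K c) = f c) /\ (forall x, g << ucm x >>%R = t x).
Proof.
exists (mmap f monom_eval); split=> [c|x]; first exact: mmapC.
rewrite [LHS]mmapU [X in X * _](rmorph1 f) mul1r /= /monom_eval.
by rewrite mdomU big_seq_fset1 cmUU expr1.
Qed.

End Lift.

(** By induction on the degree: a monomial of positive degree is a variable of its support times a
    monomial of smaller degree. Every element is then a sum of scalar multiples of monomials. *)
Lemma malg_ind (P : A -> Prop) :
  (forall c, P (@malgC {cmonom X} K c)) -> (forall x, P << ucm x >>%R) ->
  (forall a b, P a -> P b -> P (a + b)) ->
  (forall a b, P a -> P b -> P (a * b)) -> forall a, P a.
Proof.
move=> PC PX PD PM a.
have P0 : P 0 by rewrite -(rmorph0 (@malgC {cmonom X} K)); exact: PC.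
have P1 : P 1 by rewrite -(rmorph1 (@malgC {cmonom X} K)); exact: PC.
have Pm n : forall m : {cmonom X}, mdeg m = n -> P << m >>%R.
  elim: n => [m /mdeg_eq0I ->|n IHn m mn]; first exact: P1.
  have /fset0Pn[x xm] : finsupp m != fset0.
    by apply: contra_eq_neq mn => m0; rewrite mdegE m0 big_seq_fset0.
  have mE : m = mmul (ucm x) (divcm m (ucm x)).
    apply/eqP/cmP => y; rewrite cmM divcmE cmU.
    by case: eqVneq => [<-|_]; rewrite ?add0n ?subn0 // subnKC // lt0n cmE_neq0.
  have -> : << m >> = << ucm x >> * << divcm m (ucm x) >> :> A.
    by rewrite malgM_def fgmulUU mulr1 -mE.
  apply: (PM _ _ (PX x)); apply: IHn.
  have : mdeg (mmul (ucm x) (divcm m (ucm x))) = n.+1 by rewrite -mE.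
  by rewrite mdegM mdegU => -[].
rewrite (monalgE a); elim/big_rec: _ => // m b _ Pb.
have -> : << a@_m *g m >>%R = @malgC {cmonom X} K a@_m * << m >>%R.
  by rewrite malgM_def fgmulUU mulr1 mul1m.
exact: (PD _ _ (PM _ _ (PC _) (Pm _ _ erefl)) Pb).
Qed.

Definition malg_free_algebra : free_algebra K X :=
  FreeAlgebra malg_lift malg_ind.

End Malg.
End Malg.

(** From here on only lifting and induction are used, not the monomial model. *)
Definition polynomials : forall K X, free_algebra K X := Malg.malg_free_algebra.

Lemma eq_mmap n (K S : nzRingType) (f f' : K -> S) (h h' : 'I_n -> S) P :
  f =1 f' -> h =1 h' -> mpoly.mmap f h P = mpoly.mmap f' h' P.
Proof.
move=> ff' hh'; apply: eq_bigr => m _; rewrite ff'; congr (_ * _).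
exact: mpoly.mmap1_eq.
Qed.

Lemma rmorph_mmap n (K S S' : nzRingType) (f : K -> S) (h : 'I_n -> S)
  (g : {rmorphism S -> S'}) P :
  g (mpoly.mmap f h P) = mpoly.mmap (g \o f) (g \o h) P.
Proof.
rewrite rmorph_sum; apply: eq_bigr => m _; rewrite rmorphM rmorph_prod.
by congr (_ * _); apply: eq_bigr => i _; rewrite rmorphXn.
Qed.

Section FreeAlgebra.
Variables (K : fieldType) (X : choiceType) (A : free_algebra K X).
Local Notation C := (falgC A).
Local Notation T := (@falgX _ _ A).

(** The morphism [g] sends the variable at t i to the i-th of n variables and all others to 0, which
    is well defined as [t] is injective. It maps the value of P back to P. *)
Lemma falgX_algebraically_independent n (t : 'I_n -> X) (P : mpoly.mpoly n K) :
  injective t -> mpoly.mmap C (T \o t) P = 0 -> P = 0.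
Proof.
move=> t_inj.
pose u x : mpoly.mpoly n K :=
  if [pick i | t i == x] is Some i then mpoly.mpolyX K (mpoly.mnm1 i) else 0.
have [g [gC gT]] := falg_lift A (@mpoly.mpolyC n K) u.
move=> /(congr1 g); rewrite rmorph0 rmorph_mmap => <-.
rewrite -[LHS]mpoly.comp_mpoly_id /mpoly.comp_mpoly; apply: eq_mmap => [c |i]; first by rewrite /= gC.
rewrite tnth_mktuple /= gT /u; case: pickP => [j /eqP/t_inj -> //|/(_ i)].
by rewrite eqxx.
Qed.
End FreeAlgebra.

Lemma exists_min_seq d (R : orderType d) (T : eqType) (w : T -> R) t s :
  exists2 p, p \in t :: s & forall q, q \in t :: s -> (w p <= w q)%O.
Proof.
elim: s => [|u s [p ps pmin]].
  by exists t; rewrite ?mem_head // => q; rewrite inE => /eqP ->.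
have perm q : (q \in [:: t, u & s]) = (q == u) || (q \in t :: s).
  by rewrite !inE orbCA.
case: (leP (w p) (w u)) => [pu|/ltW up].
  by exists p => [|q]; rewrite perm ?ps ?orbT // => /predU1P[->|/pmin].
exists u => [|q]; rewrite perm ?eqxx // => /predU1P[->//|/pmin].
exact: le_trans.
Qed.

Lemma setU1_seq (T : eqType) (x : T) (s : seq T) : [set` x :: s] = x |` [set` s].
Proof.
by apply/seteqP; split=> y /=; rewrite inE => /predU1P.
Qed.

(** * Norms on polynomials prescribed by the distances between variables *)

Section Norm.
Context {d : Order.disp_t} {R : bottomedGroupType d} {K : fieldType}
  {X : choiceType}.
Variables (vK : valuation R K) (D : ultrametric R (option X)).
Variable (A : free_algebra K X).
Local Notation C := (falgC A).
Local Notation T := (@falgX _ _ A).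
Implicit Types (S : set X) (s : seq X) (N : A -> R).

(* [None] is the auxiliary point, at which the variable is specialised to 0. *)
Definition point (a : option X) : A := oapp T 0 a.

(** The subalgebra of polynomials in the variables from S. As a predicate on the fixed algebra [A],
    it lets norms for different S be compared directly. *)
Inductive generated S : A -> Prop :=
| generatedC c : generated S (C c)
| generatedX x : S x -> generated S (T x)
| generatedD a b : generated S a -> generated S b -> generated S (a + b)
| generatedM a b : generated S a -> generated S b -> generated S (a * b).

Definition pointed S (a : option X) : Prop := oapp S True a.

Lemma generatedS S S' a : S `<=` S' -> generated S a -> generated S' a.
Proof.
move=> SS'; elim=> [c|x /SS' Sx|b c _ Gb _ Gc|b c _ Gb _ Gc].
- exact: generatedC.
- exact: generatedX.
- exact: generatedD.
- exact: generatedM.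
Qed.

Lemma generated_seq a : exists s, generated [set` s] a.
Proof.
elim/(@falg_ind _ _ A): a => [c|x|a b [s Ga] [t Gb]|a b [s Ga] [t Gb]].
- by exists [::]; exact: generatedC.
- by exists [:: x]; apply: generatedX; rewrite /= mem_head.
- exists (s ++ t); apply: generatedD; [move: Ga|move: Gb]; apply: generatedS;
    by move=> x /= xs; rewrite mem_cat xs ?orbT.
- exists (s ++ t); apply: generatedM; [move: Ga|move: Gb]; apply: generatedS;
    by move=> x /= xs; rewrite mem_cat xs ?orbT.
Qed.

Lemma generated0 S : generated S 0.
Proof. by rewrite -(rmorph0 C); exact: generatedC. Qed.

Lemma generatedN S a : generated S a -> generated S (- a).
Proof.
move=> Sa; rewrite -mulN1r; apply: generatedM => //.
by rewrite -(rmorphN1 C); exact: generatedC.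
Qed.

Lemma generatedB S a b : generated S a -> generated S b -> generated S (a - b).
Proof. by move=> Sa Sb; apply: generatedD => //; exact: generatedN. Qed.

Lemma generatedXn S a n : generated S a -> generated S (a ^+ n).
Proof.
move=> Sa; elim: n => [|n IHn]; last by rewrite exprS; exact: generatedM.
by rewrite expr0 -(rmorph1 C); exact: generatedC.
Qed.

Lemma generated_sum S (I : Type) (r : seq I) (F : I -> A) :
  (forall i, generated S (F i)) -> generated S (\sum_(i <- r) F i).
Proof.
move=> GF; elim/big_rec: _ => [|i a _ Sa]; first exact: generated0.
exact: generatedD.
Qed.

Lemma generated_point S a : pointed S a -> generated S (point a).
Proof. by case: a => [x|_]; [exact: generatedX | exact: generated0]. Qed.

(** The competitors in the maximality clause of [gauss]. These inequalities suffice to bound such a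
    function term by term on an expansion. *)
Record subnorm S N : Prop := Subnorm {
  subnormC : forall c, (N (C c) <= vK c)%O;
  subnormD : forall a b, generated S a -> generated S b ->
    (N (a + b) <= Order.max (N a) (N b))%O;
  subnormM : forall a b, generated S a -> generated S b ->
    (N (a * b) <= vmul (N a) (N b))%O;
  subnorm_point : forall a b, pointed S a -> pointed S b ->
    (N (point a - point b) <= D a b)%O
}.

(* The last clause determines [N] on [generated S], although its construction
   depends on an enumeration of [S]. *)
Record gauss S N : Prop := Gauss {
  gaussC : forall c, N (C c) = vK c;
  gaussD : forall a b, generated S a -> generated S b ->
    (N (a + b) <= Order.max (N a) (N b))%O;
  gaussM : forall a b, generated S a -> generated S b ->
    N (a * b) = vmul (N a) (N b);
  gauss_point : forall a b, pointed S a -> pointed S b ->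
    N (point a - point b) = D a b;
  gauss_eq0 : forall a, generated S a -> N a = \bot%O -> a = 0;
  gauss_max : forall M, subnorm S M ->
    forall a, generated S a -> (M a <= N a)%O
}.

Lemma gauss_subnorm S N : gauss S N -> subnorm S N.
Proof.
case=> NC ND NM NP _ _; split=> // [c|a b Sa Sb|a b Sa Sb];
  by rewrite ?NC ?NM ?NP.
Qed.

Lemma subnormS S S' M : S `<=` S' -> subnorm S' M -> subnorm S M.
Proof.
move=> SS' [MC MD MM MP]; split=> // [a b Sa Sb|a b Sa Sb|a b Sa Sb].
- by apply: MD; exact: generatedS SS' _.
- by apply: MM; exact: generatedS SS' _.
- by apply: MP; [case: a Sa {Sb}|case: b Sb {Sa}] => //= x; exact: SS'.
Qed.

(** Each of the two norms competes in the maximality of the other. *)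
Lemma gauss_unique S N N' a : gauss S N -> gauss S N' -> generated S a ->
  N a = N' a.
Proof.
move=> gN gN' Sa; apply/le_anti; rewrite (gauss_max gN' (gauss_subnorm gN)) //.
by rewrite (gauss_max gN (gauss_subnorm gN')).
Qed.

(** Without variables only constants are generated, and the evaluation [g] of all variables at 0
    recovers them. *)
Lemma gauss_set0 : exists N, gauss set0 N.
Proof.
have [g [gC gT]] := falg_lift A (idfun : {rmorphism K -> K}) (fun=> 0).
have gK a : generated set0 a -> a = C (g a).
  elim=> [c|//|b c _ eb _ ec|b c _ eb _ ec]; first by rewrite gC.
    by rewrite {1}eb {1}ec !rmorphD.
  by rewrite {1}eb {1}ec !rmorphM.
exists (fun a => vK (g a)); split.
- by move=> c; rewrite gC.
- by move=> a b _ _; rewrite rmorphD val_ultra.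
- by move=> a b _ _; rewrite rmorphM valM.
- move=> [//|] [//|] _ _; rewrite subrr rmorph0 val0; symmetry.
  exact/udist_eq_bot.
- by move=> a /gK {2}-> /val_eq_bot ->; rewrite rmorph0.
- by move=> M [MC _ _ _] a /gK aE; rewrite {1}aE.
Qed.

(** * Adjoining one variable *)

Section Step.
Variables (S : set X) (N : A -> R) (x : X) (p : option X).
Hypothesis gN : gauss S N.
Hypothesis xS : ~ S x.
Hypothesis pS : pointed S p.
Hypothesis p_min : forall q, pointed S q -> (D (Some x) p <= D (Some x) q)%O.
Let r := D (Some x) p.

Let r0 : r != \bot%O.
Proof. by apply/eqP => /udist_eq_bot xp; move: pS; rewrite -xp. Qed.

Let N0 : N 0 = \bot%O.
Proof. by rewrite -(rmorph0 C) (gaussC gN) val0. Qed.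

Let N1 : N 1 = vone.
Proof. by rewrite -(rmorph1 C) (gaussC gN) val1. Qed.

Let NN a : generated S a -> N (- a) = N a.
Proof.
move=> Sa; rewrite -mulN1r -(rmorphN1 C) (gaussM gN (generatedC _ _) Sa).
by rewrite (gaussC gN) valN val1 vmul1.
Qed.

Let Sx := x |` S.

Let Sx_sub : S `<=` Sx.
Proof. by move=> y; right. Qed.

(** The differences T x - point b and the elements a - b * T x expand to affine polynomials, so this
    computes their norms. *)
Lemma gauss_norm_affine a b :
  gauss_norm N r (a%:P + b%:P * 'X) = Order.max (N a) (vmul (N b) r).
Proof.
have coef i : (a%:P + b%:P * 'X)`_i = if i is j.+1 then b *+ (j == 0%N) else a.
  by case: i => [|i]; rewrite coefD coefMX !coefC ?addr0 ?add0r //; case: i.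
apply/le_anti/andP; split.
  apply/gauss_norm_leP => // -[|[|i]]; rewrite coef ?N0 ?vmul_botl ?le0x //.
    by rewrite vmulr1 le_max lexx.
  by rewrite mulr1n [vexp r 1]vmulr1 le_max lexx orbT.
have := gauss_norm_ge r N0 (a%:P + b%:P * 'X) 0.
have := gauss_norm_ge r N0 (a%:P + b%:P * 'X) 1.
by rewrite !coef mulr1n vmulr1 [vexp r 1]vmulr1 ge_max => -> ->.
Qed.

Lemma gauss_norm_const a : gauss_norm N r a%:P = N a.
Proof.
by have := gauss_norm_affine a 0; rewrite mul0r addr0 N0 vmul_botl max_l ?le0x.
Qed.

(* Taylor expansion in the variable [T x] around the point [p] nearest to [x]. *)
Lemma expansion_exists : exists e : {rmorphism A -> {poly A}},
  [/\ e (T x) = 'X + (point p)%:P,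
      forall a, generated S a -> e a = a%:P,
      forall a, generated Sx a -> forall i, generated S (e a)`_i &
      forall a, (e a).[T x - point p] = a].
Proof.
(* All variables other than [T x], in S or not, become constants, so evaluation at T x - point p
   gives back every element of [A]. *)
pose t y := if y == x then 'X + (point p)%:P else (T y)%:P.
have [e [eC eT]] := falg_lift A (@polyC A \o C) t.
have ex : e (T x) = 'X + (point p)%:P by rewrite eT /t eqxx.
have ey y : S y -> e (T y) = (T y)%:P.
  by move=> Sy; rewrite eT /t ifN //; apply: contra_notN xS => /eqP <-.
have coefC_gen a i : generated S a -> generated S a%:P`_i.
  by rewrite coefC; case: eqP => // _ _; exact: generated0.
exists e; split=> // a.
- elim=> [c|y /ey //|b c _ eb _ ec|b c _ eb _ ec]; first exact: eC.
    by rewrite rmorphD polyCD eb ec.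
  by rewrite rmorphM polyCM eb ec.
- elim=> [c|y [->|Sy]|b c _ eb _ ec|b c _ eb _ ec] i.
  + by rewrite eC; apply: coefC_gen; exact: generatedC.
  + rewrite ex coefD; apply: generatedD.
      by rewrite coefX -(rmorph_nat C); exact: generatedC.
    by apply: coefC_gen; exact: generated_point.
  + by rewrite ey //; apply: coefC_gen; exact: generatedX.
  + by rewrite rmorphD coefD; exact: generatedD.
  + by rewrite rmorphM coefM; apply: generated_sum => j; exact: generatedM.
- elim/(@falg_ind _ _ A): a => [c|y|b c eb ec|b c eb ec].
  + by rewrite eC hornerC.
  + rewrite eT /t; case: eqP => [->|_]; last by rewrite hornerC.
    by rewrite hornerD hornerX hornerC subrK.
  + by rewrite rmorphD hornerD eb ec.
  + by rewrite rmorphM hornerM eb ec.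
Qed.

(** The new norm is the Gauss norm, of radius the distance from x to p, of the expansion around p.
    The last clause, that p is no farther from a quotient a / b than x is, leads to closedness. *)
Lemma gauss_step : exists N', [/\ gauss Sx N',
  forall a, generated S a -> N' a = N a &
  forall a b, generated S a -> generated S b ->
    (N (a - b * point p) <= N' (a - b * T x))%O].
Proof.
have [e [ex eS eSx e_eval]] := expansion_exists.
pose N' a := gauss_norm N r (e a).
have N'S a : generated S a -> N' a = N a.
  by move=> Sa; rewrite /N' eS // gauss_norm_const.
have SxW := generatedS Sx_sub.
exists N'; split=> //; last first.
  move=> a b Sa Sb; have Gp := generated_point pS.
  (* The constant coefficient of the expansion is a - b * point p, and a Gauss norm is at least the
     norm of that coefficient. *)
  have -> : a - b * T x = (a - b * point p) + (- b) * (T x - point p).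
    by rewrite mulNr mulrBr opprB addrA subrK.
  rewrite /N' rmorphD rmorphM (rmorphB e (T x)) ex (eS _ Gp) addrK !eS //.
  - by rewrite gauss_norm_affine le_max lexx.
  - exact: generatedN.
  - by apply: generatedB => //; exact: generatedM.
(* The Gauss norm is the maximum of [D p b] and the radius; it equals [D (Some x) b] because p is
   nearest to x. *)
have NP_x b : pointed S b -> N' (T x - point b) = D (Some x) b.
  move=> Sb; have [Gp Gb] := (generated_point pS, generated_point Sb).
  rewrite /N' rmorphB ex (eS _ Gb) -addrA -polyCB addrC -['X]mul1r -polyC1.
  rewrite gauss_norm_affine N1 vmul1 (gauss_point gN) //.
  apply/le_anti; rewrite ge_max le_max p_min // andbT.
  have := udist_ultra D p b (Some x); rewrite (udist_sym D p (Some x)).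
  rewrite (max_r (p_min Sb)) => -> /=.
  by have := udist_ultra D (Some x) b p; rewrite le_max orbC.
have N'N a : generated Sx a -> N' (- a) = N' a.
  move=> Ga; rewrite /N' rmorphN; apply/le_anti/andP.
  split; apply/gauss_norm_leP => // i.
    by rewrite coefN NN ?gauss_norm_ge //; exact: eSx.
  by rewrite -NN -?coefN ?gauss_norm_ge //; exact: eSx.
split.
- by move=> c; rewrite N'S ?(gaussC gN) //; exact: generatedC.
- move=> a b Sa Sb; rewrite /N' rmorphD.
  apply: (gauss_normD _ N0 (gaussD gN)); exact: eSx.
- move=> a b Sa Sb; rewrite /N' rmorphM.
  apply: (gauss_normM r0 (generated0 S) (@generatedN S) (@generatedD S)
    (@generatedM S) N0 NN (gaussD gN) (gaussM gN)); exact: eSx.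
- have aux a b : pointed Sx a -> pointed Sx b ->
      a = Some x \/ pointed S a -> b = Some x \/ pointed S b ->
      N' (point a - point b) = D a b.
    move=> Ga Gb [->|Sa] [->|Sb].
    + rewrite subrr N'S ?N0; last exact: generated0.
      by symmetry; apply/udist_eq_bot.
    + exact: NP_x.
    + rewrite -opprB N'N ?NP_x 1?udist_sym //.
      by apply: generatedB; apply: generated_point => //; left.
    + rewrite N'S ?(gauss_point gN) //.
      by apply: generatedB; exact: generated_point.
  have split_pt a : pointed Sx a -> a = Some x \/ pointed S a.
    by case: a => [y [->|]|] /=; [left|right|right].
  by move=> a b Sa Sb; apply: aux => //; exact: split_pt.
- move=> a Ga Na; suff e0 : e a = 0 by rewrite -(e_eval a) e0 horner0.
  apply/polyP => i; rewrite coef0; apply: (gauss_eq0 gN); first exact: eSx.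
  apply/eqP; apply: contraT => Ni; have := gauss_norm_ge r N0 (e a) i.
  rewrite [gauss_norm _ _ _]Na lex0 => /negPn.
  by rewrite vmul_neq_bot // vexp_neq_bot.
(* On the expansion of a, [M] is bounded by the largest term; coefficients are handled by the
   maximality of [N], powers of T x - point p by the bound of [M] on differences. *)
- move=> M sM a Ga; have [MC MD MM MP] := sM.
  have Gr : generated Sx (T x - point p).
    apply: generatedB; first by apply: generatedX; left.
    exact/SxW/generated_point.
  rewrite -{1}(e_eval a) horner_coef.
  have M0 : M 0 = \bot%O.
    by apply/eqP; rewrite -lex0 -(rmorph0 C) -(val0 vK).
  apply: (norm_sum_le (generated0 Sx) (@generatedD Sx) M0 MD) => i _.
    by apply: generatedM; [exact/SxW/eSx | exact: generatedXn].
  apply: le_trans (gauss_norm_ge r N0 (e a) i).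
  apply: (le_trans (MM _ _ (SxW _ (eSx _ Ga i)) (generatedXn i Gr))).
  apply: vmul_le.
    exact: (gauss_max gN (subnormS Sx_sub sM) (eSx _ Ga i)).
  elim: (i : nat) => [|n IHn].
    by have := MC 1; rewrite rmorph1 val1.
  rewrite exprS; apply: (le_trans (MM _ _ Gr (generatedXn n Gr))).
  by apply: vmul_le => //; apply: (MP (Some x)); [left|case: p pS => //= y; right].
Qed.

End Step.

(** * Gluing the norms of finite sets of variables *)

Lemma nearest_point s x : exists2 p, pointed [set` s] p &
  forall q, pointed [set` s] q -> (D (Some x) p <= D (Some x) q)%O.
Proof.
have [p ps pmin] := exists_min_seq (D (Some x)) None (map Some s).
have in_points q : q \in None :: map Some s <-> pointed [set` s] q.
  case: q => [y|]; rewrite inE //=; split=> // [/mapP[z zs [->]] //|ys].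
  exact: map_f.
by exists p; [exact/in_points | move=> q /in_points; exact: pmin].
Qed.

Lemma gauss_extend s N t : gauss [set` s] N ->
  exists2 N', gauss [set` t ++ s] N' &
    forall a, generated [set` s] a -> N' a = N a.
Proof.
move=> gN; elim: t => [|x t [N' gN' N'N]]; first by exists N.
have [xts|/negP xts] := boolP (x \in t ++ s).
  exists N' => //; suff -> : [set` (x :: t) ++ s] = [set` t ++ s] by [].
  apply/seteqP; split=> y /=; rewrite inE; last by move=> ->; rewrite orbT.
  by case/predU1P => [->|].
have [p ps pmin] := nearest_point (t ++ s) x.
have [N'' [gN'' N''N' _]] := gauss_step gN' xts ps pmin.
exists N''; first by rewrite /= setU1_seq.
move=> a Ga; rewrite N''N' ?N'N //; apply: generatedS Ga => y /= ys.
by rewrite mem_cat ys orbT.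
Qed.

Lemma gauss_exists s : exists N, gauss [set` s] N.
Proof.
have [N gN] := gauss_set0; rewrite -classical_sets.set_nil in gN.
by have [N' gN' _] := gauss_extend s gN; exists N'; rewrite -[s]cats0.
Qed.

(** Extending [N] by the variables of t gives a norm for t ++ s, which is the same set as t; there
    it agrees with N' by uniqueness. *)
Lemma gauss_compat s (t : seq X) N N' a : {subset s <= t} ->
  gauss [set` s] N -> gauss [set` t] N' -> generated [set` s] a -> N a = N' a.
Proof.
move=> st gN gN' Ga; have [M gM MN] := gauss_extend t gN.
have e : [set` t ++ s] = [set` t].
  apply/seteqP; split=> y /=; rewrite mem_cat; last by move=> ->.
  by case/orP => // /st.
rewrite e in gM; rewrite -MN //; apply: (gauss_unique gM gN').
exact: generatedS Ga.
Qed.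

Lemma norm_exists : exists N, [/\ forall s, gauss [set` s] N &
  forall a b, exists s : seq (option X), forall x, exists2 p, p \in s &
    (N (a - b * point p) <= N (a - b * T x))%O].
Proof.
have [f fP] := choice gauss_exists; have [g gP] := choice generated_seq.
(* Each element is measured with a chosen finite set of variables containing its own; compatibility
   makes the choice immaterial. *)
pose N a := f (g a) a.
have NE s a : generated [set` s] a -> N a = f s a.
  move=> Ga; rewrite /N.
  rewrite (gauss_compat _ (fP _) (fP (g a ++ s)) (gP a)); last first.
    by move=> x xs; rewrite mem_cat xs.
  symmetry; apply: gauss_compat (fP _) (fP _) Ga => x xs.
  by rewrite mem_cat xs orbT.
have gN s : gauss [set` s] N.
  have [NC ND NM NP N0 Nmax] := fP s; split.
  - by move=> c; rewrite (NE s) //; exact: generatedC.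
  - move=> a b Sa Sb; rewrite !(NE s) //; last exact: generatedD.
    exact: ND.
  - move=> a b Sa Sb; rewrite !(NE s) //; last exact: generatedM.
    exact: NM.
  - move=> a b Sa Sb; rewrite (NE s) ?NP //.
    by apply: generatedB; exact: generated_point.
  - by move=> a Sa; rewrite (NE s) //; exact: N0.
  - by move=> M sM a Sa; rewrite (NE s) //; exact: Nmax.
exists N; split=> // a b; pose s := g a ++ g b.
have Ga : generated [set` s] a.
  by apply: generatedS (gP a) => y /= ys; rewrite mem_cat ys.
have Gb : generated [set` s] b.
  by apply: generatedS (gP b) => y /= ys; rewrite mem_cat ys orbT.
(* A point of s serves for itself; for any other x the nearest among these finitely many points is
   taken. *)
exists (None :: map Some s) => x.
have [xs|/negP xs] := boolP (x \in s).
  exists (Some x); first by rewrite inE map_f ?orbT.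
  by [].
have [p ps pmin] := nearest_point s x.
have [N' [gN' N'N N'le]] := gauss_step (gN s) xs ps pmin.
exists p; first by case: p ps {pmin N'le} => [y ys|//]; rewrite inE map_f ?orbT.
rewrite -setU1_seq in gN'.
rewrite (gauss_unique (a := a - b * T x) (gN _) gN'); first exact: N'le.
have sub : [set` s] `<=` [set` x :: s] by move=> y /= ys; rewrite inE ys orbT.
apply: generatedB; first exact: generatedS sub Ga.
apply: generatedM; first exact: generatedS sub Gb.
by apply: generatedX; rewrite /= mem_head.
Qed.

End Norm.

(** * Extension of an absolute value to the fraction field *)

Record absolute_value d (R : bottomedGroupType d) (A : comNzRingType) :=
  AbsoluteValue {
  absv :> A -> R;
  absv_eq_bot : forall a, absv a = \bot%O <-> a = 0;
  absvM : forall a b, absv (a * b) = vmul (absv a) (absv b);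
  absvD : forall a b, (absv (a + b) <= Order.max (absv a) (absv b))%O
}.

Section AbsoluteValueDomain.
Context {d : Order.disp_t} {R : bottomedGroupType d} {A : comNzRingType}.

(** A copy of [A] remembering [N], since the absence of zero divisors is deduced from [N]; units and
    inverses are chosen classically. *)
Definition absv_domain (N : absolute_value R A) : Type := A.

Variable N : absolute_value R A.

HB.instance Definition _ := GRing.ComNzRing.on (absv_domain N).

Definition absv_unit : {pred absv_domain N} := fun x => `[< exists y, y * x = 1 >].

Definition absv_inv (x : absv_domain N) : absv_domain N :=
  if pselect (exists y, y * x = 1) is left xV then sval (cid xV) else x.

Lemma absv_mulVx : {in absv_unit, left_inverse 1 absv_inv *%R}.
Proof.
move=> x; rewrite unfold_in => /asboolP xU; rewrite /absv_inv.
by case: pselect => // xV; exact: svalP (cid xV).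
Qed.

Lemma absv_unitPl (x y : absv_domain N) : y * x = 1 -> absv_unit x.
Proof. by move=> yx; apply/asboolP; exists y. Qed.

Lemma absv_invr_out : {in [predC absv_unit], absv_inv =1 id}.
Proof.
move=> x; rewrite inE unfold_in => /asboolP xU; rewrite /absv_inv.
by case: pselect.
Qed.

HB.instance Definition _ := GRing.ComNzRing_hasMulInverse.Build (absv_domain N)
  absv_mulVx absv_unitPl absv_invr_out.

Lemma absv_integral : GRing.integral_domain_axiom (absv_domain N).
Proof.
move=> x y xy; apply/orP; have : vmul (N x) (N y) = \bot%O.
  by rewrite -absvM; exact/absv_eq_bot.
case: (eqVneq (N x) \bot%O) => [/absv_eq_bot -> _|x0]; first by left.
case: (eqVneq (N y) \bot%O) => [/absv_eq_bot -> _|y0]; first by right.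
by move/eqP; rewrite (negPf (vmul_neq_bot x0 y0)).
Qed.

HB.instance Definition _ :=
  GRing.ComUnitRing_isIntegral.Build (absv_domain N) absv_integral.

End AbsoluteValueDomain.

Lemma fraction_quotient (A : idomainType) (x : {fraction A}) :
  exists a b : A, b != 0 /\ x * FracField.tofrac b = FracField.tofrac a.
Proof.
elim/quotW: x => -[[a b] /= b0]; exists a, b; split=> //.
unlock FracField.tofrac; rewrite -[LHS]FracField.pi_mul.
apply/eqmodP; rewrite /= /FracField.equivf /FracField.mulf /=.
by rewrite !numden_Ratio ?mulr1 ?oner_neq0 //= mulrC.
Qed.

Lemma fraction_field_exists d (R : bottomedGroupType d) (A : comNzRingType)
    (N : absolute_value R A) :
  exists (F : fieldType) (v : valuation R F) (i : {rmorphism A -> F}),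
    (forall a, v (i a) = N a) /\
    forall x : F, exists a b : A, b != 0 /\ x * i b = i a.
Proof.
pose F : fieldType := {fraction absv_domain N}.
pose i : {rmorphism A -> F} :=
  (@FracField.tofrac (absv_domain N) : {rmorphism absv_domain N -> F}).
have i0 a : (i a == 0) = (a == 0) by exact: tofrac_eq0.
have fracP (x : F) : exists a b : A, b != 0 /\ x * i b = i a.
  by have [a [b [b0 xb]]] := fraction_quotient x; exists a, b; split.
have Nneq (b : A) : b != 0 -> N b != \bot%O.
  by apply: contra_neq => /absv_eq_bot.
(* The value is N a / N b. Quantifying over all representations a / b of x includes the independence
   of the representation. *)
have vP (x : F) : exists r : R, forall a b : A, b != 0 -> x * i b = i a ->
    vmul (N b) r = N a.
  have [a [b [b0 xb]]] := fracP x; have [w wb] := vmulV_ex (Nneq b b0).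
  exists (vmul (N a) w) => a' b' b'0 xb'; apply: (vmulI (Nneq b b0)).
  have e : a' * b = a * b'.
    by apply/eqP; rewrite -subr_eq0 -i0 rmorphB !rmorphM -xb -xb' mulrAC subrr.
  rewrite -[RHS]vmulC -absvM e absvM [in RHS]vmulC (vmulCA (N b')).
  by rewrite !(vmulCA (N b)) (vmulC (N b)) wb vmulr1 vmulC.
have [v vN] := choice vP.
have vi a : v (i a) = N a.
  have NE : N 1 = vone.
    by apply: (vmulI (Nneq 1 (oner_neq0 _))); rewrite -absvM mul1r vmulr1.
  by rewrite -[LHS]vmul1 -NE; apply: vN; rewrite ?oner_neq0 // rmorph1 mulr1.
have v0 x : v x = \bot%O <-> x = 0.
  split=> [vx|->]; last by rewrite -(rmorph0 i) vi; exact/absv_eq_bot.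
  have [a [b [b0 xb]]] := fracP x; have := vN x a b b0 xb.
  rewrite vx vmul_botr => /esym/absv_eq_bot a0; apply/eqP.
  by have /eqP := xb; rewrite a0 rmorph0 mulf_eq0 i0 (negPf b0) orbF.
(* Both remaining laws reduce to those of [N] after multiplication by the value of the common
   denominator b * b'. *)
have vM x y : v (x * y) = vmul (v x) (v y).
  have [a [b [b0 xb]]] := fracP x; have [a' [b' [b'0 yb]]] := fracP y.
  have bb0 : b * b' != 0 :> A by rewrite -i0 rmorphM mulf_neq0 ?i0.
  apply: (vmulI (Nneq _ bb0)).
  rewrite (vN _ (a * a') _ bb0); last by rewrite !rmorphM -xb -yb mulrACA.
  by rewrite !absvM -(vN x a b) // -(vN y a' b') // vmulACA.
have vD x y : (v (x + y) <= Order.max (v x) (v y))%O.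
  have [a [b [b0 xb]]] := fracP x; have [a' [b' [b'0 yb]]] := fracP y.
  have bb0 : b * b' != 0 :> A by rewrite -i0 rmorphM mulf_neq0 ?i0.
  apply: (vmul_le2lI (Nneq _ bb0)).
  rewrite (vN _ (a * b' + a' * b) _ bb0); last first.
    by rewrite rmorphD !rmorphM -xb -yb mulrDl mulrA; congr (_ + _);
      rewrite -mulrA (mulrC (i b')).
  apply: (le_trans (absvD _ _ _)); rewrite !absvM vmul_max.
  rewrite -(vN x a b) // -(vN y a' b') //.
  by rewrite -[vmul (vmul _ (v x)) _]vmulA (vmulC (v x)) !vmulA [vmul _ (N b)]vmulC vmulA.
by exists F, (Valuation v0 vM vD), i.
Qed.

(** * Neighbourhoods and Cauchy filters in terms of balls *)

Section UltrametricFilters.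
Context {d : Order.disp_t} {R : bottomedGroupType d} {X : choiceType}.
Variable D : ultrametric R X.
Local Notation U := (ultrametric_space D).

Lemma ultrametric_nbhsP (x : U) (A : set U) : nbhs x A <->
  exists2 e : R, e != \bot%O & forall y, (D x y < e)%O -> A y.
Proof.
rewrite -nbhs_entourageE; split=> [[E [e /= e0 eE] EA]|[e e0 eA]].
  by exists e => // y xy; apply: EA; apply/xsectionP; exact: eE.
exists [set xy | (D xy.1 xy.2 < e)%O]; first by exists e.
by move=> y /xsectionP /= /eA.
Qed.

Lemma ultrametric_cauchyP (G : set_system U) : Filter G -> cauchy G ->
  forall e : R, e != \bot%O -> exists2 A, G A &
    forall x y, A x -> A y -> (D x y < e)%O.
Proof.
move=> FG cG e e0.
have [|[P Q] /= [GP GQ] PQ] := cG [set xy | (D xy.1 xy.2 < e)%O].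
  by exists e.
by exists (P `&` Q); [exact: filterI | move=> x y [Px _] [_ Qy]; exact: (PQ (x, y))].
Qed.

End UltrametricFilters.

(** * Completion of a valued field by Cauchy nets *)

Section Completion.
Context {d : Order.disp_t} {R : bottomedGroupType d} {F : fieldType}.
Variable v : valuation R F.

(* The index set of nets, directed towards [\bot]; the value of a net at [\bot]
   itself is irrelevant. *)
Definition scale : Type := R.
HB.instance Definition _ := Choice.on scale.
HB.instance Definition _ := isPointed.Build scale (vone : R).

Implicit Types (a b : scale -> F) (e r s : R).

Definition near_bot (P : R -> Prop) : Prop :=
  exists2 e : R, e != \bot%O & forall s, s != \bot%O -> (s <= e)%O -> P s.

Lemma near_botS (P Q : R -> Prop) :
  (forall s, P s -> Q s) -> near_bot P -> near_bot Q.
Proof. by move=> PQ [e e0 eP]; exists e => // s s0 se; exact/PQ/eP. Qed.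

Lemma near_botI (P Q : R -> Prop) :
  near_bot P -> near_bot Q -> near_bot (fun s => P s /\ Q s).
Proof.
move=> [e e0 eP] [f f0 fQ]; exists (Order.min e f); first by case: leP.
by move=> s s0; rewrite le_min => /andP[se sf]; split; [exact: eP | exact: fQ].
Qed.

Lemma near_bot_ex (P : R -> Prop) : near_bot P -> exists s, P s.
Proof. by move=> [e e0 eP]; exists e; exact: eP. Qed.

Lemma near_botT (P : R -> Prop) : (forall s, P s) -> near_bot P.
Proof. by move=> h; exists vone; rewrite ?vone_neq_bot. Qed.

Lemma val_lt e x y : (v x < e)%O -> (v y < e)%O -> (v (x + y) < e)%O.
Proof.
by move=> xe ye; apply: le_lt_trans (val_ultra _ _ _) _; rewrite gt_max xe.
Qed.

Lemma val_dominant x y : (v y < v x)%O -> v (x + y) = v x.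
Proof.
move=> yx; apply/le_anti/andP; split.
  by apply: (le_trans (val_ultra _ _ _)); rewrite ge_max lexx ltW.
rewrite leNgt; apply/negP => h.
by have := val_lt h (y := - y); rewrite valN addrK ltxx => /(_ yx).
Qed.

(* By the ultrametric inequality, being within [e] of some constant for every [e]
   is the same as being Cauchy. *)
Definition cauchy_net a : Prop :=
  forall e, e != \bot%O -> exists c, near_bot (fun s => (v (a s - c)%R < e)%O).

Definition null_net a : Prop :=
  forall e, e != \bot%O -> near_bot (fun s => (v (a s) < e)%O).

Definition cauchy_pred : {pred scale -> F} := fun a => `[< cauchy_net a >].

Lemma cauchy_net_bounded a : cauchy_net a ->
  exists2 m, m != \bot%O & near_bot (fun s => (v (a s) <= m)%O).
Proof.
move=> /(_ vone vone_neq_bot) [c ac]; exists (Order.max (v c) vone).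
  by rewrite -lt0x lt_max !lt0x vone_neq_bot orbT.
apply: near_botS ac => s sc; rewrite -[a s](subrK c).
apply: (le_trans (val_ultra _ _ _)).
by rewrite ge_max !le_max lexx (ltW sc) orbT.
Qed.

Lemma cauchy_subring_closed : subring_closed cauchy_pred.
Proof.
split=> [|a b|a b]; rewrite ?unfold_in.
- apply/asboolP => e e0; exists 1; apply: near_botT => s.
  by rewrite subrr val0 lt0x.
- move=> /asboolP ca /asboolP cb; apply/asboolP => e e0.
  have [x ax] := ca e e0; have [y bx] := cb e e0; exists (x - y).
  apply: near_botS (near_botI ax bx) => s [sx sy].
  have -> : (a - b) s - (x - y) = (a s - x) + (y - b s).
    by rewrite [(a - b) s]/(a s - b s) opprB addrACA [RHS]addrACA (addrC (- x)).
  by apply: val_lt => //; rewrite valB.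
- move=> /asboolP ca /asboolP cb; apply/asboolP => e e0.
  (* In a b - x y = a (b - y) + y (a - x), first y is chosen using the bound m on a, then x to a
     precision depending on y. *)
  have [m m0 am] := cauchy_net_bounded ca.
  have [e1 e10 me1] := vmul_small m0 e0.
  have [y bx] := cb e1 e10.
  have [e2 e20 ye2] : exists2 e' : R, e' != \bot%O &
      forall z, (z < e')%O -> (vmul (v y) z < e)%O.
    have [->|y0] := eqVneq (v y) \bot%O.
      by exists vone; rewrite ?vone_neq_bot // => z _; rewrite vmul_botl lt0x.
    have [e' e'0 ye'] := vmul_small y0 e0; exists e' => // z; exact: ye'.
  have [x ax] := ca e2 e20; exists (x * y).
  apply: near_botS (near_botI am (near_botI ax bx)) => s [sm [sx sy]].
  have -> : (a * b) s - x * y = a s * (b s - y) + y * (a s - x).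
    by rewrite [(a * b) s]/(a s * b s) !mulrBr (mulrC y) (mulrC y) addrA subrK.
  by apply: val_lt; rewrite valM; [exact: me1 | exact: ye2].
Qed.

HB.instance Definition _ :=
  GRing.isSubringClosed.Build (scale -> F) cauchy_pred cauchy_subring_closed.

Record cauchy_ring := CauchyRing {
  net :> scale -> F;
  net_cauchyP : net \in cauchy_pred
}.

HB.instance Definition _ := [isSub for net].
HB.instance Definition _ := [Choice of cauchy_ring by <:].
HB.instance Definition _ := [SubChoice_isSubComNzRing of cauchy_ring by <:].

Implicit Types x y z : cauchy_ring.

Lemma net_cauchy x : cauchy_net x.
Proof. exact/asboolP/net_cauchyP. Qed.

(** A net that is not eventually below e is eventually within e of some c of value at least e, and
    then has the value of c. *)
Lemma net_dichotomy x : null_net x \/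
  exists2 r, r != \bot%O & near_bot (fun s => v (x s) = r).
Proof.
have [|/existsNP[e /not_implyP[e0 xe]]] := pselect (null_net x); first by left.
right; have [c xc] := net_cauchy x e0.
have ec : (e <= v c)%O.
  rewrite leNgt; apply/negP => ce; apply: xe; apply: near_botS xc => s sc.
  by rewrite -[net x s](subrK c); exact: val_lt.
exists (v c); first by rewrite -lt0x (lt_le_trans _ ec) // lt0x.
apply: near_botS xc => s sc; rewrite -[net x s](subrK c) addrC.
by rewrite val_dominant // (lt_le_trans sc).
Qed.

(** Strict upper bounds describe the limit of the values uniformly for null nets and for nets of
    eventually constant value. *)
Lemma net_val_exists x : exists r, forall e, e != \bot%O ->
  (r < e)%O <-> near_bot (fun s => (v (x s) < e)%O).
Proof.
have [nx|[r r0 xr]] := net_dichotomy x.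
  by exists \bot%O => e e0; rewrite lt0x e0; split=> // _; exact: nx.
exists r => e e0; split=> [re|xe]; first by apply: near_botS xr => s ->.
by have [s [<-]] := near_bot_ex (near_botI xr xe).
Qed.

Definition net_val x : R := sval (cid (net_val_exists x)).

Lemma net_valP x e : e != \bot%O ->
  (net_val x < e)%O <-> near_bot (fun s => (v (x s) < e)%O).
Proof. by rewrite /net_val; case: cid => r /= h; exact: h. Qed.

Lemma net_val_unique x r :
  (forall e, e != \bot%O -> (r < e)%O <-> near_bot (fun s => (v (x s) < e)%O)) ->
  net_val x = r.
Proof.
move=> rP; case: (ltgtP (net_val x) r) => // h.
  have r0 : r != \bot%O by rewrite -lt0x (le_lt_trans _ h) ?le0x.
  by move: h => /(net_valP _ r0)/(rP _ r0); rewrite ltxx.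
have r0 : net_val x != \bot%O by rewrite -lt0x (le_lt_trans _ h) ?le0x.
by move: h => /(rP _ r0)/(net_valP _ r0); rewrite ltxx.
Qed.

Lemma net_val_eq x r : near_bot (fun s => v (x s) = r) -> net_val x = r.
Proof.
move=> xr; apply: net_val_unique => e e0; split=> [re|xe].
  by apply: near_botS xr => s ->.
by have [s [<-]] := near_bot_ex (near_botI xr xe).
Qed.

Lemma net_val_eq_bot x : net_val x = \bot%O <-> null_net x.
Proof.
split=> [x0 e e0|nx]; first by apply/net_valP; rewrite // x0 lt0x.
by apply: net_val_unique => e e0; rewrite lt0x e0; split=> // _; exact: nx.
Qed.

Lemma net_val_stable x : net_val x != \bot%O ->
  near_bot (fun s => v (x s) = net_val x).
Proof.
have [/net_val_eq_bot ->|[r r0 xr] _] := net_dichotomy x; first by rewrite eqxx.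
by rewrite (net_val_eq xr).
Qed.

Lemma net_valM x y : net_val (x * y) = vmul (net_val x) (net_val y).
Proof.
have nullM z t : null_net z -> null_net (z * t : cauchy_ring).
  move=> nz e e0; have [m m0 tm] := cauchy_net_bounded (net_cauchy t).
  have [e' e'0 me'] := vmul_small m0 e0.
  apply: near_botS (near_botI tm (nz e' e'0)) => s [sm se].
  have -> : net (z * t) s = net t s * net z s by exact: mulrC.
  by rewrite valM; exact: me'.
have [x0|x0] := eqVneq (net_val x) \bot%O.
  by rewrite x0 vmul_botl; apply/net_val_eq_bot/nullM/net_val_eq_bot.
have [y0|y0] := eqVneq (net_val y) \bot%O.
  by rewrite y0 vmul_botr mulrC; apply/net_val_eq_bot/nullM/net_val_eq_bot.
apply: net_val_eq.
apply: near_botS (near_botI (net_val_stable x0) (net_val_stable y0)) => s [<- <-].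
exact: valM.
Qed.

Lemma net_valD x y : (net_val (x + y) <= Order.max (net_val x) (net_val y))%O.
Proof.
rewrite leNgt; apply/negP; rewrite gt_max => /andP[].
have [->|e0] := eqVneq (net_val (x + y)) \bot%O; first by rewrite ltx0.
move=> /(net_valP _ e0) xe /(net_valP _ e0) ye.
have : (net_val (x + y) < net_val (x + y))%O; last by rewrite ltxx.
by apply/(net_valP _ e0); apply: near_botS (near_botI xe ye) => s []; exact: val_lt.
Qed.

Lemma net_val1 : net_val 1 = vone.
Proof. by apply: net_val_eq; apply: near_botT => s; rewrite -(val1 v). Qed.

Lemma net_valN x : net_val (- x) = net_val x.
Proof.
by apply: net_val_unique => e e0; rewrite net_valP //; split; apply: near_botS => s;
  rewrite [net (- x) s]/(- net x s) valN.
Qed.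

Definition null_ideal : {pred cauchy_ring} := fun x => net_val x == \bot%O.

Lemma null_ideal_closed : idealr_closed null_ideal.
Proof.
split=> [||z x y]; rewrite !unfold_in.
- by apply/eqP/net_val_eq_bot => e e0; apply: near_botT => s; rewrite val0 lt0x.
- by rewrite net_val1 vone_neq_bot.
- move=> /eqP x0 /eqP y0; rewrite -lex0; apply: (le_trans (net_valD _ _)).
  by rewrite net_valM x0 y0 vmul_botr maxxx.
Qed.

HB.instance Definition _ :=
  isIdealr.Build cauchy_ring null_ideal null_ideal_closed.

Definition completion : Type := {ideal_quot null_ideal}.
HB.instance Definition _ := GRing.ComNzRing.on completion.

Local Notation pi := (\pi_{ideal_quot null_ideal}%qT).

Lemma completion_pi_eq0 x : (pi x == 0) = (net_val x == \bot%O).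
Proof.
by rewrite -[x in RHS]subr0 -[RHS]/(_ \in null_ideal) Quotient.idealrBE;
  congr (_ == _); rewrite piE.
Qed.

Definition net_inv x : scale -> F := fun s => (x s)^-1.

Lemma net_inv_cauchy x : net_val x != \bot%O -> net_inv x \in cauchy_pred.
Proof.
move=> x0; apply/asboolP => e e0; have xr := net_val_stable x0.
set r := net_val x in x0 xr; have r2 := vmul_neq_bot x0 x0.
(* The bound r forces v c = r; the other bound then suffices as 1/x - 1/c = (c - x) / (x c) and x c
   has value r r. *)
pose e' := Order.min r (vmul (vmul r r) e).
have [c xc] : exists c, near_bot (fun s => (v (net x s - c)%R < e')%O).
  by apply: net_cauchy; rewrite /e'; case: leP => _ //; exact: vmul_neq_bot.
have cr : v c = r.
  have [s [sr]] := near_bot_ex (near_botI xr xc); rewrite lt_min => /andP[sc _].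
  by rewrite -[c](subKr (net x s)) val_dominant // valN sr.
exists c^-1; apply: near_botS (near_botI xr xc) => s [sr].
rewrite lt_min => /andP[_]; apply: contraTT; rewrite -!leNgt => /(vmul_le2l (vmul r r)).
have nz t : v t = r -> t != 0.
  by move=> tr; apply: contra_eq_neq tr => ->; rewrite val0 eq_sym.
move=> /le_trans; apply; rewrite -{1}sr -{1}cr -!valM /net_inv valB.
rewrite mulrBr mulfK ?nz // mulrAC divff ?mul1r ?nz //.
Qed.

Definition completion_inv (q : completion) : completion :=
  if q == 0 then 0 else pi (insubd (0 : cauchy_ring) (net_inv (repr q))).

Lemma completion_mulVf q : q != 0 -> completion_inv q * q = 1.
Proof.
move=> q0; rewrite /completion_inv (negPf q0); move: q0.
rewrite -{1 3}[q]reprK completion_pi_eq0; set x := repr q => x0.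
rewrite -rmorphM -[RHS](rmorph1 pi); apply/eqP; rewrite -subr_eq0 -rmorphB.
rewrite completion_pi_eq0; apply/eqP/net_val_eq_bot => e e0.
apply: near_botS (net_val_stable x0) => s xs.
set y := insubd _ _; have yE : net y = net_inv x by rewrite insubdK ?net_inv_cauchy.
have -> : net (y * x - 1) s = net y s * net x s - 1 by [].
have xs0 : net x s != 0.
  by apply: contra_neq x0 => xs0; rewrite -xs xs0 val0.
by rewrite yE /net_inv mulVf // subrr val0 lt0x.
Qed.

Lemma completion_inv0 : completion_inv 0 = 0.
Proof. by rewrite /completion_inv eqxx. Qed.

HB.instance Definition _ :=
  GRing.ComNzRing_isField.Build completion completion_mulVf completion_inv0.

Definition completion_val (q : completion) : R := net_val (repr q).

(** Nets that differ by a null net have the same value. *)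
Lemma completion_val_pi x : completion_val (pi x) = net_val x.
Proof.
have aux y z : net_val (y - z) = \bot%O -> (net_val y <= net_val z)%O.
  move=> yz; rewrite -[y in net_val y](subrK z).
  by apply: (le_trans (net_valD _ _)); rewrite yz max_r ?le0x.
have e : net_val (repr (pi x) - x) = \bot%O.
  by apply/eqP; rewrite -completion_pi_eq0 rmorphB /= reprK subrr.
by apply/le_anti; rewrite !aux // -net_valN opprB.
Qed.

Lemma completion_val_eq_bot q : completion_val q = \bot%O <-> q = 0.
Proof.
elim/quotW: q => x; rewrite completion_val_pi; split=> [/eqP|/eqP].
  by rewrite -completion_pi_eq0 => /eqP.
by rewrite completion_pi_eq0 => /eqP.
Qed.

Lemma completion_valM q q' :
  completion_val (q * q') = vmul (completion_val q) (completion_val q').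
Proof.
elim/quotW: q => x; elim/quotW: q' => y.
by rewrite -rmorphM !completion_val_pi net_valM.
Qed.

Lemma completion_valD q q' :
  (completion_val (q + q') <= Order.max (completion_val q) (completion_val q'))%O.
Proof.
elim/quotW: q => x; elim/quotW: q' => y.
by rewrite -rmorphD !completion_val_pi net_valD.
Qed.

Definition completion_valuation : valuation R completion :=
  Valuation completion_val_eq_bot completion_valM completion_valD.

Lemma const_cauchy (c : F) : (fun _ : scale => c) \in cauchy_pred.
Proof.
apply/asboolP => e e0; exists c; apply: near_botT => s.
by rewrite subrr val0 lt0x.
Qed.

Definition completion_embed (c : F) : completion :=
  pi (CauchyRing (const_cauchy c)).

Lemma completion_embed_zmod_morphism : zmod_morphism completion_embed.
Proof.
move=> a b; rewrite /completion_embed -rmorphB; congr (pi _).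
exact: val_inj.
Qed.

Lemma completion_embed_monoid_morphism : monoid_morphism completion_embed.
Proof.
split=> [|a b]; rewrite /completion_embed.
  by rewrite -(rmorph1 pi); congr (pi _); exact: val_inj.
by rewrite -rmorphM; congr (pi _); exact: val_inj.
Qed.

HB.instance Definition _ := GRing.isZmodMorphism.Build F completion
  completion_embed completion_embed_zmod_morphism.
HB.instance Definition _ := GRing.isMonoidMorphism.Build F completion
  completion_embed completion_embed_monoid_morphism.

Lemma completion_val_embed c : completion_val (completion_embed c) = v c.
Proof. by rewrite completion_val_pi; apply: net_val_eq; exact: near_botT. Qed.

Lemma completion_val_sub_embed x c e : e != \bot%O ->
  (completion_val (pi x - completion_embed c) < e)%O <->
  near_bot (fun s => (v (net x s - c)%R < e)%O).
Proof.
by move=> e0; rewrite /completion_embed -rmorphB completion_val_pi net_valP.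
Qed.

Lemma completion_dense q e : e != \bot%O ->
  exists c, (completion_val (q - completion_embed c) < e)%O.
Proof.
elim/quotW: q => x e0; have [c xc] := net_cauchy x e0.
by exists c; apply/completion_val_sub_embed.
Qed.

(** For each scale s, choose a member of the filter of diameter below s, a point in it, and an
    element [k s] of the field within s of that point. The class of the net [k] is the limit. *)
Lemma completion_complete :
  complete_uniform (ultrametric_space (valuation_ultrametric completion_valuation)).
Proof.
set D := valuation_ultrametric _; set w := completion_valuation.
move=> G PG /ultrametric_cauchyP cG.
have wlt q q' t e : (w (q - t)%R < e)%O -> (w (t - q')%R < e)%O -> (w (q - q')%R < e)%O.
  by move=> h h'; apply: le_lt_trans (udist_ultra D q q' t) _; rewrite gt_max h.
have kP (s : scale) : exists Aqk : set completion * completion * F,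
    s != \bot%O :> R -> [/\ G Aqk.1.1, Aqk.1.1 Aqk.1.2,
      forall q q', Aqk.1.1 q -> Aqk.1.1 q' -> (w (q - q')%R < s)%O &
      (w (Aqk.1.2 - completion_embed Aqk.2)%R < s)%O].
  (* Nothing is required at [\bot], so the triple is a placeholder. *)
  have [->|s0] := eqVneq (s : R) \bot%O; first by exists (setT, 0, 0).
  have [A GA As] := cG s s0; have [q Aq] := filter_ex GA.
  by have [c qc] := completion_dense q s0; exists (A, q, c).
have [f fP] := choice kP; pose k s := (f s).2.
(* The sets chosen at scales s and e meet, both belonging to the filter; the chain from q to [k s]
   goes through a common point. *)
have k_close (s e : R) q : s != \bot%O -> (s <= e)%O -> e != \bot%O -> (f e).1.1 q ->
    (w (q - completion_embed (k s))%R < e)%O.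
  move=> s0 se e0 Aq.
  have [Gs As sA ks] := fP s s0; have [Ge Ae eA _] := fP e e0.
  have [t [At1 At2]] := filter_ex (filterI Gs Ge).
  apply: (wlt _ _ t); first exact: eA.
  apply: (wlt _ _ (f s).1.2); first exact: lt_le_trans (sA _ _ At1 As) se.
  exact: lt_le_trans ks se.
have k_cauchy : k \in cauchy_pred.
  apply/asboolP => e e0; exists (k e); exists e => // s s0 se.
  have [Ge Ae eA _] := fP e e0.
  rewrite -completion_val_embed rmorphB; apply: (wlt _ _ (f e).1.2).
    by rewrite valB; exact: k_close.
  exact: k_close.
exists (pi (CauchyRing k_cauchy)) => A /ultrametric_nbhsP [e e0 eA].
have [Ge Ae eA' _] := fP e e0; apply: filterS Ge => q Aq; apply: eA.
rewrite udist_sym; change (is_true (w (q - pi (CauchyRing k_cauchy))%R < e)%O).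
apply: (wlt _ _ (completion_embed (k e))).
  exact: k_close.
rewrite valB; apply/completion_val_sub_embed => //=.
exists e => // s s0 se; rewrite -completion_val_embed rmorphB.
by apply: (wlt _ _ (f e).1.2); [rewrite valB; exact: k_close | exact: k_close].
Qed.

End Completion.

(** * Algebraic independence under inclusions and field morphisms *)

Section AlgebraicIndependence.
Variables (K L : fieldType) (j : {rmorphism K -> L}).

Lemma algebraically_independentS (S S' : set L) :
  S `<=` S' -> algebraically_independent j S' -> algebraically_independent j S.
Proof. by move=> SS' h n t t_inj tS P; apply: h => // i; exact/SS'/tS. Qed.

Lemma algebraically_independent_comp (L' : fieldType) (f : {rmorphism L -> L'})
    (X : Type) (I : X -> L) :
  algebraically_independent j (range I) ->
  algebraically_independent (f \o j) (range (f \o I)).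
Proof.
move=> h n t t_inj tI P.
have /choice[x xt] i : exists x, f (I x) = t i by have [x _ <-] := tI i; exists x.
have tE : t =1 f \o (I \o x) by move=> i; rewrite -xt.
rewrite (eq_mmap _ (fun=> erefl) tE) -rmorph_mmap => /eqP; rewrite fmorph_eq0 => /eqP.
apply: h => [i i' e|i]; last by exists (x i).
by apply: t_inj; rewrite !tE /=; congr (f _).
Qed.

End AlgebraicIndependence.

(** * Constructions of ultrametric spaces *)

Section Ultrametrics.
Context {d : Order.disp_t} {R : bottomedGroupType d}.

Lemma udistxx (X : Type) (D : ultrametric R X) x : D x x = \bot%O.
Proof. exact/udist_eq_bot. Qed.

Section AddPoint.
Variables (X : Type) (D : ultrametric R X) (c : X -> R).
Hypothesis c_ge1 : forall x, (vone <= c x)%O.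
Hypothesis c_lip : forall x y, (c x <= Order.max (D x y) (c y))%O.
Hypothesis c_cover : forall x y, (D x y <= Order.max (c x) (c y))%O.

(** Here [c x] is the distance from x to the new point; [c_lip] and [c_cover] are the ultrametric
    inequalities for triangles through it. *)
Definition add_point_dist (a b : option X) : R :=
  match a, b with
  | Some x, Some y => D x y
  | Some x, None | None, Some x => c x
  | None, None => \bot%O
  end.

Lemma add_point_neq_bot x : c x <> \bot%O.
Proof.
move=> cx; have := c_ge1 x; rewrite cx lex0.
by rewrite (negPf vone_neq_bot).
Qed.

Lemma add_point_sym a b : add_point_dist a b = add_point_dist b a.
Proof. by case: a b => [x|] [y|] //=; exact: udist_sym. Qed.

Lemma add_point_eq_bot a b : add_point_dist a b = \bot%O <-> a = b.
Proof.
case: a b => [x|] [y|] //=; try by split=> // /add_point_neq_bot.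
by rewrite udist_eq_bot; split=> [->|[]].
Qed.

Lemma add_point_ultra a b e :
  (add_point_dist a b <= Order.max (add_point_dist a e) (add_point_dist e b))%O.
Proof.
case: a b e => [x|] [y|] [z|] //=; rewrite ?le0x //.
- exact: udist_ultra.
- by rewrite le_max lexx.
- by rewrite maxC udist_sym.
- by rewrite le_max lexx orbT.
Qed.

Definition add_point : ultrametric R (option X) :=
  Ultrametric add_point_sym add_point_eq_bot add_point_ultra.

End AddPoint.

(* The lower bound keeps 0, the image of the added point, out of the closure of
   the set of variables. *)
Lemma add_point_exists (X : Type) (D : ultrametric R X) :
  exists D' : ultrametric R (option X),
    (forall x y, D' (Some x) (Some y) = D x y) /\
    (forall x, (vone <= D' None (Some x))%O).
Proof.
have [c [c1 clip ccov]] : exists c : X -> R, [/\ forall x, (vone <= c x)%O,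
    forall x y, (c x <= Order.max (D x y) (c y))%O &
    forall x y, (D x y <= Order.max (c x) (c y))%O].
  have [[x0 _]|X0] := pselect (exists _ : X, True); last first.
    by exists (fun=> vone); split=> x; case: X0; exists x.
  (* The new point imitates x0, with distances raised to at least [vone]. *)
  exists (fun x => Order.max (D x x0) vone); split=> x => [|y|y].
  - by rewrite le_max lexx orbT.
  - rewrite ge_max !le_max lexx !orbT andbT orbA -le_max.
    by rewrite udist_ultra.
  - apply: (le_trans (udist_ultra D x y x0)); rewrite (udist_sym D x0).
    by rewrite ge_max !le_max !lexx !orbT.
by exists (add_point c1 clip ccov).
Qed.

(** The distance of distinct points is the larger of the two, so every element of [R] occurs as its
    own distance to [\bot]. *)
Lemma max_ultrametric_exists : exists D : ultrametric R R,
  forall r, D r \bot%O = r.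
Proof.
pose D (r s : R) := if r == s then \bot%O else Order.max r s.
have sym r s : D r s = D s r by rewrite /D eq_sym maxC.
have eq_bot r s : D r s = \bot%O <-> r = s.
  rewrite /D; case: eqP => [//|rs]; split=> // e; case: rs.
  have : (Order.max r s <= \bot)%O by rewrite e.
  by rewrite ge_max !lex0 => /andP[/eqP -> /eqP ->].
have ultra r s t : (D r s <= Order.max (D r t) (D t s))%O.
  rewrite /D; case: (eqVneq r s) => [_|rs]; first by rewrite le0x.
  case: (eqVneq r t) rs => [->|rt] rs.
    by rewrite (negPf rs) le_max lexx orbT.
  case: (eqVneq t s) => [->|_]; first by rewrite le_max lexx.
  by rewrite ge_max !le_max !lexx !orbT.
exists (Ultrametric sym eq_bot ultra) => r /=; rewrite /D.
by case: eqP => [->|_] //; rewrite max_l ?le0x.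
Qed.

(** The maximum of two pseudo-ultrametrics: the pullback of D along a left inverse [h] of g,
    arbitrary outside the image, and [e], which separates points of Z by [vone] unless both lie in
    the image. *)
Lemma ultrametric_extend (X Z : Type) (D : ultrametric R X) (g : X -> Z) :
  injective g -> X -> exists E : ultrametric R Z, forall x y, E (g x) (g y) = D x y.
Proof.
move=> g_inj x0.
have hP z : exists x, (exists y, g y = z) -> g x = z.
  by have [[x xz]|nz] := pselect (exists x, g x = z); [exists x | exists x0].
have [h hg] := choice hP; have gK x : h (g x) = x.
  by apply: g_inj; apply: hg; exists x.
pose near z t := z = t \/ (exists x, g x = z) /\ (exists x, g x = t).
pose e z t : R := if `[< near z t >] then \bot%O else vone.
have e_ultra z t u : (e z t <= Order.max (e z u) (e u t))%O.
  rewrite /e; case: asboolP => [_|zt]; first by rewrite le0x.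
  rewrite le_max; case: asboolP => [zu|_]; last by rewrite lexx.
  case: asboolP => [ut|_]; last by rewrite lexx orbT.
  by case: zt; case: zu => [->//|[gz gu]]; case: ut => [<-|[_ gt]]; right.
pose E z t := Order.max (D (h z) (h t)) (e z t).
have E_sym z t : E z t = E t z.
  rewrite /E udist_sym; congr Order.max; rewrite /e; congr (if _ then _ else _).
  by apply: asbool_equiv_eq; rewrite /near; intuition.
have E_eq_bot z t : E z t = \bot%O <-> z = t.
  split=> [zt|->]; last first.
    by rewrite /E udistxx /e max_r ?le0x // ifT //; apply/asboolP; left.
  have : (E z t <= \bot)%O by rewrite zt.
  rewrite ge_max !lex0 /e => /andP[/eqP/udist_eq_bot hzt].
  case: asboolP => [[//|[[x xz] [y yt]]] _|_]; last by rewrite (negPf vone_neq_bot).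
  by rewrite -xz -yt -(gK x) -(gK y) xz yt hzt.
have E_ultra z t u : (E z t <= Order.max (E z u) (E u t))%O.
  rewrite ge_max; apply/andP; split.
    by apply: (le_trans (udist_ultra D _ _ (h u))); rewrite le_max2 // le_max lexx.
  by apply: (le_trans (e_ultra z t u)); rewrite le_max2 // le_max lexx orbT.
exists (Ultrametric E_sym E_eq_bot E_ultra) => x y; rewrite /= /E !gK max_l //.
rewrite /e ifT ?le0x //; apply/asboolP; right.
by split; [exists x | exists y].
Qed.

(* The space is the wedge sum of all ultrametrics on [Z], each one extended by a
   point at distance [max (D z o) vone] from [z], at which the wedge is taken. *)
Lemma universal_ultrametric_exists (Z : Type) (o : Z) :
  exists (U : choiceType) (DU : ultrametric R U),
    forall (X : Type) (D : ultrametric R X) (g : X -> Z), injective g -> X ->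
    exists I : X -> U, forall x y, DU (I x) (I y) = D x y.
Proof.
(* A pair is a point of the summand named by its first component. The wedge point is left out of
   [U]; only the distances [c] to it enter. *)
pose U := {classic (ultrametric R Z * Z)%type}.
have [c [c0 c_le le_c]] : exists c : U -> R, [/\ forall u, c u <> \bot%O,
    forall (E : ultrametric R Z) z t, (c (E, z) <= Order.max (E z t) (c (E, t)))%O &
    forall (E : ultrametric R Z) z t, (E z t <= Order.max (c (E, z)) (c (E, t)))%O].
  exists (fun u : ultrametric R Z * Z => Order.max (u.1 u.2 o) vone); split=> [u|E z t|E z t] /=.
  - by move=> /eqP; rewrite -lex0 ge_max !lex0 (negPf vone_neq_bot) andbF.
  - rewrite ge_max !le_max lexx !orbT andbT orbA -le_max.
    by rewrite udist_ultra.
  - apply: (le_trans (udist_ultra E z t o)); rewrite (udist_sym E o).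
    by rewrite le_max2 // le_max lexx.
pose DU (u w : U) :=
  if `[< u.1 = w.1 >] then u.1 u.2 w.2 else Order.max (c u) (c w).
have sym u w : DU u w = DU w u.
  rewrite /DU; case: asboolP => [e|ne]; case: asboolP => [e'|ne'].
  - by rewrite udist_sym e.
  - by case: ne'.
  - by case: ne.
  - by rewrite maxC.
have eq_bot u w : DU u w = \bot%O <-> u = w.
  rewrite /DU; case: asboolP => [e|ne].
    case: u w e => [E z] [E' t] /= <-; rewrite udist_eq_bot.
    by split=> [->|[]].
  split=> [/eqP|uw]; last by case: ne; rewrite uw.
  by rewrite -lex0 ge_max !lex0 => /andP[/eqP/c0].
have ultra u w t : (DU u w <= Order.max (DU u t) (DU t w))%O.
  case: u w t => [E z] [E' z'] [E'' z'']; rewrite /DU /=.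
  case: (asboolP (E = E')) => [<-|EE'].
    have -> : `[< E'' = E >] = `[< E = E'' >] by apply: asbool_equiv_eq.
    case: (asboolP (E = E'')) => [<-|EE'']; first exact: udist_ultra.
    apply: (le_trans (le_c E z z')).
    by rewrite ge_max !le_max !lexx !orbT.
  case: (asboolP (E = E'')) => [<-|EE''].
    case: asboolP => // _; rewrite ge_max [in X in _ && X]le_max.
    by rewrite [in X in _ && X]le_max lexx !orbT andbT maxA le_max c_le.
  case: (asboolP (E'' = E')) => [<-|_]; last by rewrite ge_max !le_max !lexx !orbT.
  have := c_le E'' z' z''; rewrite udist_sym ge_max !le_max lexx /=.
  by case/orP => ->; rewrite ?orbT.
exists U, (Ultrametric sym eq_bot ultra) => X D g g_inj x0.
have [E Eg] := ultrametric_extend D g_inj x0.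
exists (fun x => (E, g x)) => x y /=; rewrite /DU /=.
by case: asboolP.
Qed.

End Ultrametrics.

(** * Closed images of ultrametric spaces *)

Section Closedness.
Context {d : Order.disp_t} {R : bottomedGroupType d} {X Y : choiceType}.
Variables (DX : ultrametric R X) (DY : ultrametric R Y) (f : X -> Y).

Lemma range_closedP :
  (forall y, (forall e, e != \bot%O -> exists x, (DY y (f x) < e)%O) ->
    exists x, f x = y) <-> ultrametric_closed DY (range f).
Proof.
split=> [h y cly|clf y h].
  have [e e0|x <-] := h y; last by exists x.
  have [_ [[x _ <-] yx]] := cly [set z | (DY y z < e)%O]
    ((ultrametric_nbhsP (D := DY) y _).2 (ex_intro2 _ _ e e0 (fun z yz => yz))).
  by exists x.
have [B /ultrametric_nbhsP[e e0 eB]|x _ <-] := clf y; last by exists x.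
by have [x yx] := h e e0; exists (f x); split; [exists x | exact: eB].
Qed.

(** The preimages of the balls around a limit point y form a Cauchy filter on X. If its limit x had
    f x different from y, the ball of radius their distance would give a contradiction. *)
Lemma complete_isometric_closed :
  isometric_embedding DX DY f -> complete_uniform (ultrametric_space DX) ->
  ultrametric_closed DY (range f).
Proof.
move=> fD cX; apply/range_closedP => y yf.
pose B (e : R) := [set x : ultrametric_space DX | (DY y (f x) < e)%O].
pose G := filter_from [set e : R | e != \bot%O] B.
have FG : Filter G.
  apply: filter_from_filter; first by exists vone; exact: vone_neq_bot.
  move=> e e' e0 e'0; exists (Order.min e e') => /=; first by case: leP.
  by move=> x; rewrite /B /= lt_min => /andP[].
have PG : ProperFilter G.
  by apply: filter_from_proper => e /= e0; exact: yf.
have [A [e /= e0 eA]|x Gx] := cX G PG.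
  exists (B e, B e) => /=; first by split; exists e.
  move=> [x z] /= [xe ze]; apply: eA => /=.
  rewrite -fD; apply: le_lt_trans (udist_ultra DY _ _ y) _.
  by rewrite gt_max udist_sym xe.
exists x; symmetry; apply/(udist_eq_bot DY)/eqP; apply: contraT => yx.
have : G [set z | (DX x z < DY y (f x))%O].
  by apply: Gx; apply/ultrametric_nbhsP; exists (DY y (f x)).
have GB : G (B (DY y (f x))) by exists (DY y (f x)).
move=> /(filterI GB)/filter_ex[z [/= yz xz]].
have := udist_ultra DY y (f x) (f z); rewrite (udist_sym DY (f z)) fD.
by rewrite leNgt gt_max yz xz.
Qed.

End Closedness.

(** * Valued fields generated by ultrametric spaces *)

Section ValuedFields.
Context {d : Order.disp_t} {R : bottomedGroupType d} {K : fieldType}.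
Variable vK : valuation R K.

Lemma polynomial_valued_field_exists (X : choiceType)
    (D : ultrametric R (option X)) :
  exists (F : fieldType) (vF : valuation R F) (j : {rmorphism K -> F})
    (I : X -> F),
    [/\ valued_extension vK vF j,
        forall a b, vF (oapp I 0 a - oapp I 0 b) = D a b,
        algebraically_independent j (range I) &
        forall q, exists s : seq (option X), forall x, exists2 a, a \in s &
          (vF (q - oapp I 0 a) <= vF (q - I x))%O].
Proof.
have [N [gN Nnear]] := norm_exists vK D (polynomials K X).
set A := polynomials K X in N gN Nnear.
have gen2 (a b : A) : exists s : seq X, generated [set` s] a /\ generated [set` s] b.
  have [s Ga] := generated_seq a; have [t Gb] := generated_seq b.
  exists (s ++ t); split; [move: Ga|move: Gb]; apply: generatedS;
    by move=> x /= xs; rewrite mem_cat xs ?orbT.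
have NC c : N (falgC A c) = vK c := gaussC (gN [::]) c.
have NM a b : N (a * b) = vmul (N a) (N b).
  by have [s [Ga Gb]] := gen2 a b; exact: (gaussM (gN s)).
have ND a b : (N (a + b) <= Order.max (N a) (N b))%O.
  by have [s [Ga Gb]] := gen2 a b; exact: (gaussD (gN s)).
have N0 a : N a = \bot%O <-> a = 0.
  split=> [|->]; last by rewrite -(rmorph0 (falgC A)) NC val0.
  by have [s Ga] := generated_seq a; exact: (gauss_eq0 (gN s)).
have NP a b : N (point A a - point A b) = D a b.
  have [s [sa sb]] : exists s : seq X, pointed [set` s] a /\ pointed [set` s] b.
    by case: a => [x|]; case: b => [y|];
      [exists [:: x; y]|exists [:: x]|exists [:: y]|exists [::]];
      rewrite /= ?inE ?eqxx ?orbT.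
  exact: (gauss_point (gN s)).
have [F [vF [i [vi fracF]]]] := fraction_field_exists (AbsoluteValue N0 NM ND).
have i_inj a : i a = 0 -> a = 0.
  by move=> ia; apply/N0; rewrite -[N a]vi ia val0.
have iP a : oapp (i \o @falgX _ _ A) 0 a = i (point A a).
  by case: a => //=; rewrite rmorph0.
exists F, vF, (i \o falgC A), (i \o @falgX _ _ A); split.
- by move=> c; rewrite /= vi; exact: NC.
- by move=> a b; rewrite !iP -rmorphB vi; exact: NP.
- move=> n t t_inj tI P.
  have /choice[x xt] k : exists x, i (falgX A x) = t k.
    by have [x _ <-] := tI k; exists x.
  rewrite (eq_mmap _ (fun=> erefl) (fun k => esym (xt k))) -(rmorph_mmap _ _ i).
  move=> /i_inj; apply: falgX_algebraically_independent => k l kl.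
  by apply: t_inj; rewrite -!xt kl.
(* Writing q = a / b, the distance from q to a point c is the norm of a - b c divided by that of
   b. *)
- move=> q; have [a [b [b0 qb]]] := fracF q.
  have [s sP] := Nnear a b; exists s => x; have [p ps ple] := sP x; exists p => //.
  have Nb : N b != \bot%O by apply: contra_neq b0 => /N0.
  have NE c : N (a - b * c) = vmul (N b) (vF (q - i c)).
    rewrite -[LHS]vi -[N b]vi -valM rmorphB rmorphM -qb.
    by congr (vF _); rewrite mulrBr (mulrC q).
  by apply: (vmul_le2lI Nb); rewrite iP -!NE.
Qed.

Lemma valued_field_embedding (X : choiceType) (D : ultrametric R X) :
  exists (F : fieldType) (vF : valuation R F) (j : {rmorphism K -> F})
    (I : X -> F),
    [/\ valued_extension vK vF j,
        isometric_embedding D (valuation_ultrametric vF) I,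
        algebraically_independent j (range I) &
        ultrametric_closed (valuation_ultrametric vF) (range I)].
Proof.
have [D' [D'D D'1]] := add_point_exists D.
have [F [vF [j [I [vj vI indI near]]]]] := polynomial_valued_field_exists D'.
exists F, vF, j, I; split=> //.
  by move=> x y; rewrite -D'D -vI.
apply/range_closedP => q qI; have [s sP] := near q.
(* Either q is one of the finitely many points of s, or its distances to them have a lower bound
   other than [\bot], which by [sP] bounds its distance to all variables. *)
have [[a as_ qa]|s_far] := pselect (exists2 a, a \in s & vF (q - oapp I 0 a) = \bot%O).
  have {qa} : q = oapp I 0 a by apply/eqP; rewrite -subr_eq0; apply/eqP/val_eq_bot/qa.
  (* The auxiliary point 0 is excluded: it is at distance at least [vone] from all variables. *)
  case: a as_ => [x|] _ /= qE; first by exists x.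
  have [x] := qI vone vone_neq_bot; rewrite qE [_ 0 _](vI None (Some x)).
  by rewrite ltNge D'1.
have [|e e0 es] := exists_neq_bot_le (s := s) (w := fun a => vF (q - oapp I 0 a)).
  by move=> a sa; apply/eqP => qa; apply: s_far; exists a.
have [x qx] := qI e e0; have [a sa ax] := sP x.
by have := lt_le_trans (le_lt_trans ax qx) (es a sa); rewrite ltxx.
Qed.

End ValuedFields.

Theorem theorem5p1 (p : nat) (kappa : Type)
    (d : Order.disp_t) (R : bottomedGroupType d)
    (K : fieldType) (vK : valuation R K) :
  p = 0%N \/ prime p ->
  has_characteristic (residue_field vK) p ->
  divisible R ->
  (exists (L : fieldType) (vL : valuation R L) (j : {rmorphism K -> L}),
     [/\ valued_extension vK vL j,
         range vL = [set: R] &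
         forall (X : choiceType) (D : ultrametric R X),
           [set: X] = set0 \/ [set: option X] #<= [set: kappa] ->
           exists I : X -> L,
             isometric_embedding D (valuation_ultrametric vL) I /\
             algebraically_independent j (range I)])
  /\
  (forall (X : choiceType) (D : ultrametric R X),
     exists (F : fieldType) (vF : valuation R F) (j : {rmorphism K -> F})
       (I : X -> F),
       [/\ isometric_embedding D (valuation_ultrametric vF) I,
           valued_extension vK vF j,
           ultrametric_closed (valuation_ultrametric vF) (range I),
           algebraically_independent j (range I) &
           complete_uniform (ultrametric_space D) ->
           complete_uniform
             (ultrametric_space (valuation_ultrametric vF))]).
Proof.
move=> _ _ _; split.
  (* The index set must receive all spaces of the bounded size and also [R] itself, which is used
     for the surjectivity of the valuation. *)
  have [U [DU DU_univ]] := universal_ultrametric_exists (R := R)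
    (inr \bot%O : kappa + R).
  have [L [vL [j [J [vj J_iso J_ind _]]]]] := valued_field_embedding vK DU.
  exists L, vL, j; split=> //.
    apply/seteqP; split=> // r _.
    (* Since [R] embeds isometrically, r is the value of the difference of the images of r and
       [\bot]. *)
    have [E Er] := max_ultrametric_exists (R := R).
    have [|I I_iso] := DU_univ _ E (inr : R -> kappa + R) _ vone.
      by move=> s t [].
    by exists (J (I r) - J (I \bot%O)); rewrite // -[RHS]Er -I_iso; exact: J_iso.
  move=> X D X_card.
  (* The universal space receives inhabited spaces; the empty one embeds vacuously. *)
  have [[x0 _]|X0] := pselect (exists x : X, [set: X] x); last first.
    exists (fun=> 0); split=> [x y|]; first by case: X0; exists x.
    by apply: algebraically_independentS J_ind => z [x]; case: X0; exists x.
  case: X_card => [X0|/card_leP[f]]; first by have : [set: X] x0 by []; rewrite X0.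
  pose g x : kappa + R := inl (val (f (to_setT (Some x)))).
  have g_inj : injective g.
    move=> x y [/val_inj fxy].
    by have /(congr1 val)[] := inj (mem_set Logic.I) (mem_set Logic.I) fxy.
  have [I I_iso] := DU_univ X D g g_inj x0.
  exists (J \o I); split=> [x y|]; first by rewrite -I_iso -J_iso.
  by apply: algebraically_independentS J_ind => _ [x _ <-]; exists (I x).
move=> X D.
have [F [vF [j [I [vj I_iso I_ind I_closed]]]]] := valued_field_embedding vK D.
(* Completing the field could add limits of variables; when X is complete its image stays closed,
   and otherwise the field is kept. *)
have [cD|ncD] := pselect (complete_uniform (ultrametric_space D)); last first.
  by exists F, vF, j, I; split.
have I_iso' : isometric_embedding D (valuation_ultrametric (completion_valuation vF))
    (completion_embed vF \o I).
  move=> x y; rewrite -I_iso -[LHS]/(completion_val (_ - _)) -rmorphB.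
  exact: completion_val_embed.
exists (completion vF), (completion_valuation vF), (completion_embed vF \o j),
  (completion_embed vF \o I); split=> //.
- by move=> c; rewrite -vj; exact: completion_val_embed.
- exact: complete_isometric_closed I_iso' cD.
- exact: algebraically_independent_comp.
- by move=> _; exact: completion_complete.
Qed.
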